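(* Let $k\ge 1$ be an integer and, for each integer $N\ge 1$, let $h=1/N$, let $\mathcal{V}_h^k$ be the space defined in the context, and let $P=P_h:L^2(0,1)\to\mathcal{V}_h^k$ be the $L^2(0,1)$-orthogonal projection. (i) If $k=2\kappa+1$ with $\kappa\in\{0,1,2,\dots\}$ and $u\in C_p^{k+2}$, then there exists a constant $C_k>0$, independent of $h$ and of $u$, such that for every $N\ge 1$, $$\|P[(Pu-u)_x]\|\le C_k\,h^{k+1}\,\|u^{(k+2)}\|_\infty .$$ (ii) If $k=1$ and $u\in C_p^{5}$, then there exists a constant $C_1>0$, independent of $h$ and of $u$, such that for every $N\ge 1$, $$\|P[(Pu-u)_x]\|\le C_1\,h^{4}\,\|u^{(5)}\|_\infty .$$
   Context: $C_p$ denotes the space of continuous $1$-periodic functions $f:\mathbb{R}\to\mathbb{R}$, and $C_p^m$ the set of $f\in C_p$ whose derivatives $f^{(j)}$, $j=1,\dots,m$, also lie in $C_p$. For $N\ge1$, $h=1/N$ and nodes $x_i=ih$, $i\in\mathbb{Z}$ (a uniform $1$-periodic partition of $\mathbb{R}$). $\mathcal{V}_h^k=\{\phi\in C_p:\ \phi|_{[x_{i-1},x_i]}\text{ is a polynomial of degree at most }k\text{ for } i=1,\dots,N\}$ (continuous periodic Lagrange finite elements of degree $k$). $(\cdot,\cdot)$ and $\|\cdot\|$ are the inner product and norm of $L^2(0,1)$, and $\|\cdot\|_\infty$ is the sup norm. For $u\in C_p^1$, $(Pu-u)_x$ is the (piecewise defined, square-integrable) derivative of $Pu-u$. *)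

(* Defs.v *)
From Stdlib Require Import Reals.
From Coquelicot Require Import Coquelicot.
Open Scope R_scope.

Definition periodic1 (f : R -> R) : Prop := forall x, f (x + 1) = f x.

Definition Cp (f : R -> R) : Prop :=
  periodic1 f /\ forall x, continuous f x.

(* C_p^m : f in C_p whose derivatives f^(j), j = 1..m, exist and lie in C_p
   (periodicity of the derivatives follows from that of f). *)
Definition Cpm (m : nat) (f : R -> R) : Prop :=
  Cp f /\
  (forall j x, (j < m)%nat -> ex_derive (Derive_n f j) x) /\
  (forall j, (j <= m)%nat -> Cp (Derive_n f j)).

Definition poly_eval (c : nat -> R) (k : nat) (x : R) : R :=
  sum_f_R0 (fun j => c j * x ^ j) k.

Definition Vhk (N k : nat) (phi : R -> R) : Prop :=
  Cp phi /\
  forall i : nat, (1 <= i <= N)%nat ->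
    exists c : nat -> R, forall x,
      INR (i - 1) / INR N <= x <= INR i / INR N -> phi x = poly_eval c k x.

Definition L2ip (f g : R -> R) : R := RInt (fun x => f x * g x) 0 1.
Definition L2norm (f : R -> R) : R := sqrt (L2ip f f).

Definition is_L2proj (N k : nat) (f p : R -> R) : Prop :=
  Vhk N k p /\
  forall phi, Vhk N k phi -> L2ip (fun x => f x - p x) phi = 0.

Definition dx_diff (Pu u : R -> R) : R -> R :=
  fun x => Derive (fun y => Pu y - u y) x.

(* Main.v *)
Require Import Defs.
From Stdlib Require Import Reals Lra Lia Factorial.
From Coquelicot Require Import Coquelicot.
Open Scope R_scope.

(** Odd [k].  On each cell, subtract from the Taylor polynomial of degree [k+1] of [u] its leading
    coefficient times the monic shifted Legendre polynomial [e] of degree [k+1].  As [k+1] is even,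
    [e 0 = e 1], so these pieces are continuous up to [O(h^(k+2))] and can be corrected to a finite
    element function; hence, up to multiples of [e] on each cell, [Pu - u] is [O(h^(k+2))] in
    [L^2].  Testing [(Pu - u)_x] against [w = P[(Pu - u)_x]] and integrating by parts, the multiples
    of [e] disappear by orthogonality, and the inverse inequality for [w_x] costs one power of [h].

    [k = 1].  The mass matrix and the central difference are circulant, so they commute; this
    turns a translate-weighted version of [(w, w)] into the pairing of [w] with the error of
    Simpson's rule applied to [u'] on [[x - h, x + h]], which is [O(h^4)]. *)

(** * Continuous functions, their integrals, and the inner product *)

Definition cts (f : R -> R) : Prop := forall x, continuous f x.

Lemma cts_const a : cts (fun _ => a).
Proof. intro x; apply continuous_const. Qed.

Lemma cts_id : cts (fun x => x).
Proof. intro x; apply continuous_id. Qed.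

Lemma cts_plus f g : cts f -> cts g -> cts (fun x => f x + g x).
Proof. intros Hf Hg x; apply (continuous_plus f g); auto. Qed.

Lemma cts_minus f g : cts f -> cts g -> cts (fun x => f x - g x).
Proof. intros Hf Hg x; apply (continuous_minus f g); auto. Qed.

Lemma cts_mult f g : cts f -> cts g -> cts (fun x => f x * g x).
Proof. intros Hf Hg x; apply (continuous_mult f g); auto. Qed.

Lemma cts_pow f n : cts f -> cts (fun x => f x ^ n).
Proof.
  intro Hf; induction n as [|n IH].
  - exact (cts_const 1).
  - exact (cts_mult _ _ Hf IH).
Qed.

Lemma cts_div f a : cts f -> cts (fun x => f x / a).
Proof. intro Hf; apply (cts_mult f (fun _ => / a)); [exact Hf | apply cts_const]. Qed.

Lemma cts_comp f g : cts f -> cts g -> cts (fun x => f (g x)).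
Proof. intros Hf Hg x; apply (continuous_comp g f); auto. Qed.

Lemma cts_ext f g : (forall x, f x = g x) -> cts f -> cts g.
Proof. intros H Hf x; apply (continuous_ext f); auto. Qed.

Lemma cts_ex_RInt f a b : cts f -> ex_RInt f a b.
Proof. intro Hf; apply (@ex_RInt_continuous R_CompleteNormedModule); auto. Qed.

(** The opening [change] eta-expands the goal so that its head operation can be matched
    syntactically; composition is tried after the arithmetic cases, with a hypothesis for the outer
    function. *)
Ltac cts_tac :=
  try (lazymatch goal with |- cts ?f => change (cts (fun x => f x)) end); cbv beta;
  first [assumption | lazymatch goal with
  | |- cts (fun x => _ + _) => apply cts_plus; cts_tac
  | |- cts (fun x => _ - _) => apply cts_minus; cts_tac
  | |- cts (fun x => _ * _) => apply cts_mult; cts_tac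
  | |- cts (fun x => _ / _) => apply cts_div; cts_tac
  | |- cts (fun x => _ ^ _) => apply cts_pow; cts_tac
  | |- cts (fun x => x) => apply cts_id
  | |- _ => first [assumption | apply cts_const
      | match goal with H : cts ?f |- cts (fun x => ?f _) => apply (cts_comp f); [exact H | cts_tac] end]
  end].

Lemma is_RInt_plus_R f g a b l m :
  is_RInt f a b l -> is_RInt g a b m -> is_RInt (fun x => f x + g x) a b (l + m).
Proof. exact (is_RInt_plus f g a b l m). Qed.

Lemma is_RInt_scal_R f a b c l :
  is_RInt f a b l -> is_RInt (fun x => c * f x) a b (c * l).
Proof. exact (is_RInt_scal f a b c l). Qed.

Lemma RInt_cts (f : R -> R) a b : cts f -> is_RInt f a b (RInt f a b).
Proof. intro Hf; apply (@RInt_correct R_CompleteNormedModule), cts_ex_RInt, Hf. Qed.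

Lemma RInt_lin (f g : R -> R) a b c d :
  cts f -> cts g ->
  RInt (fun x => c * f x + d * g x) a b = c * RInt f a b + d * RInt g a b.
Proof.
  intros Hf Hg; apply (@is_RInt_unique R_CompleteNormedModule).
  apply is_RInt_plus_R; apply is_RInt_scal_R; apply RInt_cts; assumption.
Qed.

Lemma RInt_eq (f g : R -> R) a b : (forall x, f x = g x) -> RInt f a b = RInt g a b.
Proof. intro H; apply RInt_ext; intros; apply H. Qed.

Lemma RInt_const_R (c a b : R) : RInt (fun _ => c) a b = (b - a) * c.
Proof. exact (RInt_const a b c). Qed.

Lemma L2ip_lin_l f g p c d :
  cts f -> cts g -> cts p ->
  L2ip (fun x => c * f x + d * g x) p = c * L2ip f p + d * L2ip g p.
Proof.
  intros Hf Hg Hp; unfold L2ip.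
  rewrite <- RInt_lin by cts_tac.
  apply RInt_eq; intro; ring.
Qed.

Lemma L2ip_sym f g : L2ip f g = L2ip g f.
Proof. apply RInt_eq; intro; ring. Qed.

Lemma L2ip_lin_r f g p c d :
  cts f -> cts g -> cts p ->
  L2ip p (fun x => c * f x + d * g x) = c * L2ip p f + d * L2ip p g.
Proof.
  intros; rewrite L2ip_sym, L2ip_lin_l, (L2ip_sym f), (L2ip_sym g); auto.
Qed.

Lemma L2ip_ext f f' g g' :
  (forall x, f x = f' x) -> (forall x, g x = g' x) -> L2ip f g = L2ip f' g'.
Proof. intros Hf Hg; apply RInt_eq; intro; rewrite Hf, Hg; reflexivity. Qed.

Lemma L2ip_ge_0 f : cts f -> 0 <= L2ip f f.
Proof.
  intro Hf; apply RInt_ge_0; [lra | apply cts_ex_RInt; cts_tac | intros; nra].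
Qed.

(** If [f x] were nonzero, the square of [f] would stay above half its value at [x] on a short
    interval, and the integral would be positive. *)
Lemma L2ip_eq_0 f : cts f -> L2ip f f = 0 -> forall x, 0 <= x <= 1 -> f x = 0.
Proof.
  intros Hf H0 x Hx.
  destruct (Req_dec (f x) 0) as [E|E]; [exact E | exfalso].
  assert (Hf2 : cts (fun y => f y * f y)) by cts_tac.
  destruct (Hf2 x (fun y => f x * f x / 2 < y)) as [d Hd].
  { apply open_gt. nra. }
  simpl in Hd.
  (* As [x] may be an end point, the interval lies on the side with room: to the right of [x] when
     [x <= 1/2], to the left otherwise. *)
  assert (exists a b, 0 <= a < b /\ b <= 1 /\ forall y, a < y < b -> Rabs (y - x) < d)
    as (a & b & Hab & Hb & Hy).
  { assert (Hdp := cond_pos d).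
    destruct (Rle_dec x (1/2)) as [Hl|Hl].
    - exists x, (Rmin (x + d) 1).
      assert (x < Rmin (x + d) 1) by (apply Rmin_glb_lt; lra).
      assert (Rmin (x + d) 1 <= x + d) by apply Rmin_l.
      assert (Rmin (x + d) 1 <= 1) by apply Rmin_r.
      repeat split; try lra. intros y Hy; apply Rabs_def1; lra.
    - exists (Rmax (x - d) 0), x.
      assert (Rmax (x - d) 0 < x) by (apply Rmax_lub_lt; lra).
      assert (x - d <= Rmax (x - d) 0) by apply Rmax_l.
      assert (0 <= Rmax (x - d) 0) by apply Rmax_r.
      repeat split; try lra. intros y Hy; apply Rabs_def1; lra. }
  assert (Hpos : 0 < RInt (fun y => f y * f y) a b).
  { apply RInt_gt_0; [lra | | auto].
    intros y Hyy. apply Rle_lt_trans with (f x * f x / 2); [nra|].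
    apply Hd. apply Hy, Hyy. }
  assert (Hs : forall p q, p <= q -> 0 <= RInt (fun y => f y * f y) p q).
  { intros p q Hpq; apply RInt_ge_0; [lra | apply cts_ex_RInt; cts_tac | intros; nra]. }
  unfold L2ip in H0.
  rewrite <- (RInt_Chasles (fun y => f y * f y) 0 a 1) in H0 by (apply cts_ex_RInt; cts_tac).
  rewrite <- (RInt_Chasles (fun y => f y * f y) a b 1) in H0 by (apply cts_ex_RInt; cts_tac).
  unfold plus in H0; simpl in H0.
  assert (H1 := Hs 0 a); assert (H2 := Hs b 1). lra.
Qed.

(** * Polynomials of bounded degree *)

Definition ispoly (k : nat) (f : R -> R) : Prop :=
  exists c, forall x, f x = poly_eval c k x.

Lemma ispoly_ext k f g : (forall x, f x = g x) -> ispoly k f -> ispoly k g.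
Proof. intros H [c Hc]; exists c; intro; rewrite <- H; apply Hc. Qed.

Lemma ispoly_lin k f g a b :
  ispoly k f -> ispoly k g -> ispoly k (fun x => a * f x + b * g x).
Proof.
  intros [c Hc] [d Hd]; exists (fun j => a * c j + b * d j); intro x.
  rewrite Hc, Hd; unfold poly_eval.
  rewrite !scal_sum, <- plus_sum; apply sum_eq; intros; ring.
Qed.

Lemma ispoly_0 f : ispoly 0 f <-> exists a, forall x, f x = a.
Proof.
  split.
  - intros [c Hc]; exists (c 0%nat); intro; rewrite Hc; unfold poly_eval; simpl; ring.
  - intros [a Ha]; exists (fun _ => a); intro; rewrite Ha; unfold poly_eval; simpl; ring.
Qed.

Lemma ispoly_S k f :
  ispoly (S k) f <-> exists r a, ispoly k r /\ forall x, f x = r x + a * x ^ S k.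
Proof.
  split.
  - intros [c Hc]; exists (poly_eval c k), (c (S k)); split.
    + exists c; reflexivity.
    + intro x; rewrite Hc; reflexivity.
  - intros (r & a & [c Hc] & Hf).
    exists (fun j => if Nat.eq_dec j (S k) then a else c j); intro x.
    rewrite Hf, Hc; unfold poly_eval; rewrite tech5; f_equal.
    + apply sum_eq; intros i Hi; destruct (Nat.eq_dec i (S k)); [lia | reflexivity].
    + destruct (Nat.eq_dec (S k) (S k)); [reflexivity | lia].
Qed.

Lemma ispoly_weaken k f : ispoly k f -> ispoly (S k) f.
Proof. intro H; apply ispoly_S; exists f, 0; split; [exact H | intro; ring]. Qed.

Lemma ispoly_const k a : ispoly k (fun _ => a).
Proof.
  induction k as [|k IH]; [apply ispoly_0; exists a; reflexivity | apply ispoly_weaken, IH].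
Qed.

Lemma ispoly_pow k : ispoly k (fun x => x ^ k).
Proof.
  destruct k as [|k].
  - apply ispoly_0; exists 1; reflexivity.
  - apply ispoly_S; exists (fun _ => 0), 1; split; [apply ispoly_const | intro; ring].
Qed.

Lemma ispoly_mult_id k f : ispoly k f -> ispoly (S k) (fun x => x * f x).
Proof.
  revert f; induction k as [|k IH]; intros f Hf.
  - apply ispoly_0 in Hf; destruct Hf as [a Ha].
    apply ispoly_S; exists (fun _ => 0), a; split.
    + apply ispoly_const.
    + intro; rewrite Ha; simpl; ring.
  - apply ispoly_S in Hf; destruct Hf as (r & a & Hr & Hf).
    apply ispoly_S; exists (fun x => x * r x), a; split.
    + apply IH, Hr.
    + intro; rewrite Hf; simpl; ring.
Qed.

Lemma ispoly_affine k f a b : ispoly k f -> ispoly k (fun x => f (a * x + b)).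
Proof.
  revert f; induction k as [|k IH]; intros f Hf.
  - apply ispoly_0 in Hf; destruct Hf as [c Hc].
    apply ispoly_0; exists c; auto.
  - apply ispoly_S in Hf; destruct Hf as (r & c & Hr & Hf).
    assert (H1 := IH _ (ispoly_pow k)).
    (* With [y = a x + b], the power [y^(S k)] is [a x y^k + b y^k]. *)
    assert (H2 := ispoly_lin (S k) _ _ a b (ispoly_mult_id k _ H1) (ispoly_weaken _ _ H1)).
    assert (H3 := ispoly_lin (S k) _ _ 1 c (ispoly_weaken _ _ (IH _ Hr)) H2).
    eapply ispoly_ext; [|exact H3].
    intro x; cbv beta; rewrite Hf; simpl; ring.
Qed.

Lemma ispoly_is_derive k f :
  ispoly k f -> exists df, ispoly k df /\ forall x, is_derive f x (df x).
Proof.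
  revert f; induction k as [|k IH]; intros f Hf.
  - apply ispoly_0 in Hf; destruct Hf as [a Ha].
    exists (fun _ => 0); split; [apply ispoly_const|].
    intro x; apply (is_derive_ext (fun _ => a)); [auto | apply @is_derive_const].
  - apply ispoly_S in Hf; destruct Hf as (r & a & Hr & Hf).
    destruct (IH _ Hr) as (dr & Hdr & Hd).
    exists (fun x => 1 * dr x + (a * INR (S k)) * x ^ k); split.
    + apply ispoly_weaken, ispoly_lin; [exact Hdr | apply ispoly_pow].
    + intro x; apply (is_derive_ext (fun y => r y + a * y ^ S k)); [intro; symmetry; apply Hf|].
      replace (1 * dr x + a * INR (S k) * x ^ k)
        with (dr x + a * (INR (S k) * 1 * x ^ pred (S k))) by (simpl pred; ring).
      apply (is_derive_plus r (fun y => a * y ^ S k)); [apply Hd|].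
      apply is_derive_scal, is_derive_pow; exact (is_derive_id (x : R_AbsRing)).
Qed.

(** The degree bound is not lowered: orthogonality to degree at most [k] is all that is asked of the
    derivative later. *)
Lemma ispoly_Derive k f : ispoly k f -> ispoly k (Derive f).
Proof.
  intro Hf; destruct (ispoly_is_derive k f Hf) as (df & Hdf & H).
  apply (ispoly_ext k df); [|exact Hdf].
  intro x; symmetry; apply is_derive_unique, H.
Qed.

Lemma ispoly_ex_derive k f x : ispoly k f -> ex_derive f x.
Proof. intro Hf; destruct (ispoly_is_derive k f Hf) as (df & _ & H); exists (df x); apply H. Qed.

Lemma ispoly_cts k f : ispoly k f -> cts f.
Proof.
  intros Hf x; apply (@ex_derive_continuous R_AbsRing R_NormedModule), (ispoly_ex_derive k), Hf.
Qed.

(** * Orthogonal projection onto polynomials and the inverse inequality *)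

Lemma L2ip_0_r f g : cts f -> cts g -> L2ip g g = 0 -> L2ip f g = 0.
Proof.
  intros Hf Hg H; unfold L2ip.
  rewrite (RInt_ext _ (fun _ => 0)).
  - rewrite RInt_const_R; ring.
  - intros x; rewrite Rmin_left, Rmax_right by lra; intro Hx.
    rewrite (L2ip_eq_0 g Hg H) by lra; apply Rmult_0_r.
Qed.

(** One Gram-Schmidt step per degree: [e], the new monomial minus its projection, is orthogonal to
    lower degrees, and the lower projection [r] is corrected by the [e]-component of [f - r]. *)
Lemma ispoly_proj k f :
  cts f ->
  exists q, ispoly k q /\ forall p, ispoly k p -> L2ip (fun x => f x - q x) p = 0.
Proof.
  revert f; induction k as [|k IH]; intros f Hf.
  - exists (fun _ => L2ip f (fun _ => 1)); split; [apply ispoly_const|].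
    intros p Hp; apply ispoly_0 in Hp; destruct Hp as [a Ha].
    set (m := L2ip f (fun _ => 1)).
    rewrite (L2ip_ext _ (fun x => 1 * f x + (- m) * 1) _ (fun x => a * 1 + 0 * 0))
      by (intro; rewrite ?Ha; ring).
    rewrite L2ip_lin_r, !L2ip_lin_l by cts_tac.
    fold m; unfold L2ip; rewrite !RInt_const_R; ring.
  - destruct (IH (fun x => x ^ S k)) as (q & Hq & Hqo); [cts_tac|].
    destruct (IH f Hf) as (r & Hr & Hro).
    assert (Hqc := ispoly_cts _ _ Hq); assert (Hrc := ispoly_cts _ _ Hr).
    set (e := fun x => x ^ S k - q x).
    assert (He : cts e) by (unfold e; cts_tac).
    set (g := fun x => f x - r x).
    assert (Hg : cts g) by (unfold g; cts_tac).
    assert (Heo : forall p, ispoly k p -> L2ip e p = 0) by exact Hqo.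
    assert (Hgo : forall p, ispoly k p -> L2ip g p = 0) by exact Hro.
    set (t := L2ip g e / L2ip e e).
    exists (fun x => 1 * r x + t * e x); split.
    { apply ispoly_lin; [apply ispoly_weaken, Hr|].
      apply (ispoly_ext _ (fun x => 1 * x ^ S k + (-1) * q x)); [intro; unfold e; ring|].
      apply ispoly_lin; [apply ispoly_pow | apply ispoly_weaken, Hq]. }
    intros p Hp; apply ispoly_S in Hp; destruct Hp as (s & a & Hs & Hp).
    assert (Hsq : ispoly k (fun x => 1 * s x + a * q x)) by (apply ispoly_lin; assumption).
    assert (Hsqc := ispoly_cts _ _ Hsq).
    rewrite (L2ip_ext _ (fun x => 1 * g x + (- t) * e x)
               _ (fun x => 1 * (1 * s x + a * q x) + a * e x))
      by (intro; rewrite ?Hp; unfold g, e; ring).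
    rewrite L2ip_lin_r, !L2ip_lin_l by (assumption || cts_tac).
    rewrite Heo, Hgo by exact Hsq.
    (* That [e] is nonzero need not be shown: if its norm vanishes, so does its pairing with [g],
       and the value of the quotient [t] is irrelevant. *)
    destruct (Req_dec (L2ip e e) 0) as [E|E].
    + rewrite (L2ip_0_r g e) by assumption; rewrite E; ring.
    + unfold t; field; exact E.
Qed.

Lemma L2ip_Derive_0 k e : ispoly k e -> L2ip e e = 0 -> L2ip (Derive e) (Derive e) = 0.
Proof.
  intros He H0; unfold L2ip.
  rewrite (RInt_ext _ (fun _ => 0)).
  - rewrite RInt_const_R; ring.
  - intros x; rewrite Rmin_left, Rmax_right by lra; intro Hx.
    replace (Derive e x) with 0; [apply Rmult_0_r|].
    symmetry; apply is_derive_unique.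
    apply (is_derive_ext_loc (fun _ => 0)); [|apply @is_derive_const].
    apply (locally_interval _ x 0 1); simpl; try lra.
    intros y H1 H2; symmetry; apply L2ip_eq_0; [eapply ispoly_cts, He | exact H0 | lra].
Qed.

Lemma L2ip_sq_lin f g a b :
  cts f -> cts g ->
  L2ip (fun x => a * f x + b * g x) (fun x => a * f x + b * g x)
  = a ^ 2 * L2ip f f + 2 * a * b * L2ip f g + b ^ 2 * L2ip g g.
Proof.
  intros Hf Hg.
  rewrite L2ip_lin_r, !L2ip_lin_l by cts_tac.
  rewrite (L2ip_sym g f); ring.
Qed.

(** Induction on the degree replaces a compactness argument. Write [p = r + a e] with [e] orthogonal
    to degree at most [k]: the squared norm of [p] splits exactly, and that of the derivative splits
    up to a factor 2. *)
Lemma inverse_inequality k :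
  exists K, 0 < K /\ forall p, ispoly k p -> L2ip (Derive p) (Derive p) <= K * L2ip p p.
Proof.
  induction k as [|k (K & HK & IH)].
  - exists 1; split; [lra|]; intros p Hp.
    assert (H := L2ip_ge_0 p (ispoly_cts _ _ Hp)).
    apply ispoly_0 in Hp; destruct Hp as [a Ha].
    rewrite (L2ip_ext (Derive p) (fun _ => 0) _ (fun _ => 0)).
    + unfold L2ip at 1; rewrite RInt_const_R; lra.
    + intro x; rewrite (Derive_ext p (fun _ => a)) by exact Ha; apply Derive_const.
    + intro x; rewrite (Derive_ext p (fun _ => a)) by exact Ha; apply Derive_const.
  - destruct (ispoly_proj k (fun x => x ^ S k)) as (q & Hq & Hqo); [cts_tac|].
    set (e := fun x => x ^ S k - q x).
    assert (Hep : ispoly (S k) e).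
    { apply (ispoly_ext _ (fun x => 1 * x ^ S k + (-1) * q x)); [intro; unfold e; ring|].
      apply ispoly_lin; [apply ispoly_pow | apply ispoly_weaken, Hq]. }
    assert (He := ispoly_cts _ _ Hep).
    assert (Hde := ispoly_cts _ _ (ispoly_Derive _ _ Hep)).
    assert (Heo : forall p, ispoly k p -> L2ip e p = 0) by exact Hqo.
    assert (exists D, 0 <= D /\ L2ip (Derive e) (Derive e) <= D * L2ip e e) as (D & HD & HDe).
    { assert (H1 := L2ip_ge_0 e He). assert (H2 := L2ip_ge_0 _ Hde).
      destruct (Req_dec (L2ip e e) 0) as [E|E].
      - exists 0; split; [lra|]. rewrite (L2ip_Derive_0 _ e Hep E); lra.
      - exists (L2ip (Derive e) (Derive e) / L2ip e e); split.
        + apply Rdiv_le_0_compat; lra.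
        + right; field; exact E. }
    exists (2 * K + 2 * D); split; [lra|].
    intros p Hp; apply ispoly_S in Hp; destruct Hp as (s & a & Hs & Hp).
    set (r := fun x => 1 * s x + a * q x).
    assert (Hr : ispoly k r) by (apply ispoly_lin; assumption).
    assert (Hrc := ispoly_cts _ _ Hr).
    assert (Hdr := ispoly_cts _ _ (ispoly_Derive _ _ Hr)).
    assert (Hpe : forall x, p x = 1 * r x + a * e x) by (intro; rewrite Hp; unfold r, e; ring).
    assert (Hdp : forall x, Derive p x = 1 * Derive r x + a * Derive e x).
    { intro x; rewrite (Derive_ext p (fun y => 1 * r y + a * e y)) by exact Hpe.
      rewrite Derive_plus, !Derive_scal; try reflexivity;
        apply ex_derive_scal; eapply ispoly_ex_derive; eassumption. }
    rewrite (L2ip_ext _ _ _ _ Hpe Hpe), (L2ip_ext _ _ _ _ Hdp Hdp).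
    rewrite (L2ip_sq_lin r e) by assumption.
    rewrite (L2ip_sym r e), Heo by exact Hr.
    (* Nonnegativity of the square of [r' - a e'] bounds the cross term in the square of
       [r' + a e']. *)
    assert (Hpar := L2ip_ge_0 (fun x => 1 * Derive r x + (- a) * Derive e x)).
    rewrite L2ip_sq_lin in Hpar by assumption.
    rewrite L2ip_sq_lin by assumption.
    assert (Hpar' : cts (fun x => 1 * Derive r x + - a * Derive e x)) by cts_tac.
    specialize (Hpar Hpar'); specialize (IH r Hr).
    assert (H1 := L2ip_ge_0 e He). assert (H2 := L2ip_ge_0 _ Hrc).
    assert (H3 : 0 <= a ^ 2) by (apply pow2_ge_0).
    assert (H4 : a ^ 2 * L2ip (Derive e) (Derive e) <= a ^ 2 * (D * L2ip e e))
      by (apply Rmult_le_compat_l; assumption).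
    assert (H5 : 0 <= K * (a ^ 2 * L2ip e e))
      by (apply Rmult_le_pos; [lra | apply Rmult_le_pos; assumption]).
    assert (H6 : 0 <= D * L2ip r r) by (apply Rmult_le_pos; assumption).
    nra.
Qed.

(** * Reflection and the shifted Legendre polynomials of even degree *)

Lemma pow_reflect k :
  exists r, ispoly k r /\ forall x, (1 - x) ^ S k = (-1) ^ S k * x ^ S k + r x.
Proof.
  induction k as [|k (r & Hr & IH)].
  - exists (fun _ => 1); split; [apply ispoly_const | intro; simpl; ring].
  - exists (fun x => 1 * ((-1) ^ S k * x ^ S k + r x) + (-1) * (x * r x)); split.
    + apply ispoly_lin; [|apply ispoly_mult_id, Hr].
      apply (ispoly_ext _ (fun x => (-1) ^ S k * x ^ S k + 1 * r x)); [intro; ring|].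
      apply ispoly_lin; [apply ispoly_pow | apply ispoly_weaken, Hr].
    + intro x; change ((1 - x) ^ S (S k)) with ((1 - x) * (1 - x) ^ S k).
      rewrite IH; simpl; ring.
Qed.

(* Reflection in 1/2 preserves monic polynomials of even degree and orthogonality, so by
   uniqueness the shifted Legendre polynomial of even degree takes equal values at 0 and 1. *)
Lemma legendre_even k :
  Nat.Even (S k) ->
  exists q, ispoly k q /\
    (forall p, ispoly k p -> L2ip (fun x => x ^ S k - q x) p = 0) /\ 1 - q 1 = - q 0.
Proof.
  intros [j Hj].
  destruct (ispoly_proj k (fun x => x ^ S k)) as (q & Hq & Hqo); [cts_tac|].
  exists q; split; [exact Hq | split; [exact Hqo|]].
  assert (Hqc := ispoly_cts _ _ Hq).
  set (e := fun x => x ^ S k - q x).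
  assert (He : cts e) by (unfold e; cts_tac).
  assert (Heo : forall p, ispoly k p -> L2ip e p = 0) by exact Hqo.
  (* Change of variable [1 - x]: the sign of its derivative cancels that of the swapped limits. *)
  assert (Hrefl : forall f g, cts f -> cts g ->
    L2ip (fun x => f (1 - x)) g = L2ip f (fun x => g (1 - x))).
  { intros f g Hf Hg; unfold L2ip.
    assert (Hc : cts (fun x => f x * g (1 - x))) by cts_tac.
    assert (H := RInt_comp_lin (fun x => f x * g (1 - x)) (-1) 1 0 1 (cts_ex_RInt _ _ _ Hc)).
    replace (-1 * 0 + 1) with 1 in H by ring; replace (-1 * 1 + 1) with 0 in H by ring.
    rewrite <- (opp_RInt_swap (fun x => f x * g (1 - x)) 0 1) in H
      by (apply cts_ex_RInt, Hc).
    unfold opp in H; simpl in H.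
    apply Ropp_eq_reg; refine (eq_trans _ H).
    assert (E : @eq R (RInt (fun x => (-1) * (f (1 - x) * g x) + 0 * 0) 0 1)
                  (- RInt (fun x => f (1 - x) * g x) 0 1)).
    { rewrite RInt_lin by cts_tac; rewrite RInt_const_R; ring. }
    rewrite <- E; apply RInt_eq; intro x; unfold scal; simpl; unfold mult; simpl.
    replace (-1 * x + 1) with (1 - x) by ring.
    replace (1 - (1 - x)) with x by ring; ring. }
  (* The leading terms cancel since the degree is even, so [d] has degree at most [k] and is
     orthogonal to both [e] and its reflection, hence to itself. Its vanishing at 0 is the claim. *)
  set (d := fun x => 1 * e x + (-1) * e (1 - x)).
  assert (Hec : cts (fun x => e (1 - x))) by cts_tac.
  assert (Hd : ispoly k d).
  { assert (Hm : ispoly k (fun x => x ^ S k - (1 - x) ^ S k)).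
    { assert (Hsgn : (-1) ^ S k = 1) by (rewrite Hj; apply pow_1_even).
      destruct (pow_reflect k) as (r & Hr & Hrx).
      apply (ispoly_ext _ (fun x => (-1) * r x + 0 * r x)); [|apply ispoly_lin; exact Hr].
      intro x; rewrite Hrx, Hsgn; ring. }
    apply (ispoly_ext _ (fun x => 1 * (x ^ S k - (1 - x) ^ S k)
             + 1 * ((-1) * q x + 1 * q (-1 * x + 1)))).
    - intro x; unfold d, e; replace (-1 * x + 1) with (1 - x) by ring; ring.
    - apply ispoly_lin; [exact Hm | apply ispoly_lin; [exact Hq | apply ispoly_affine, Hq]]. }
  assert (Hdc := ispoly_cts _ _ Hd).
  assert (Hd0 : L2ip d d = 0).
  { unfold d at 1; rewrite L2ip_lin_l by assumption.
    rewrite Hrefl, (Heo d Hd) by assumption.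
    rewrite Heo; [ring|].
    apply (ispoly_ext _ (fun x => d (-1 * x + 1))); [intro; f_equal; ring|].
    apply ispoly_affine, Hd. }
  assert (H := L2ip_eq_0 d Hdc Hd0 0 ltac:(lra)).
  unfold d, e in H; replace (1 - 0) with 1 in H by ring.
  rewrite pow_i, pow1 in H by lia; lra.
Qed.

(** * Integration cell by cell, and finite element functions in local coordinates *)

Lemma L2ip_ext_01 f f' g g' :
  (forall x, 0 < x < 1 -> f x = f' x) -> (forall x, 0 < x < 1 -> g x = g' x) ->
  L2ip f g = L2ip f' g'.
Proof.
  intros Hf Hg; apply RInt_ext.
  intros x; rewrite Rmin_left, Rmax_right by lra; intro Hx.
  rewrite Hf, Hg by exact Hx; reflexivity.
Qed.

Lemma INR_S_pos n : 0 < INR (S n).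
Proof. apply lt_0_INR; lia. Qed.

(** Substitution [x = (i + s) / N]. The number of cells is written [S n], which makes it positive
    without a hypothesis. *)
Lemma is_RInt_cell (f : R -> R) i n c :
  is_RInt (fun s => f ((INR i + s) / INR (S n))) 0 1 c ->
  is_RInt f (INR i / INR (S n)) (INR (S i) / INR (S n)) (c / INR (S n)).
Proof.
  intro H; assert (HN := INR_S_pos n); set (N := INR (S n)) in *.
  replace 0 with (N * (INR i / N) + - INR i) in H by (field; lra).
  replace 1 with (N * (INR (S i) / N) + - INR i) in H by (rewrite S_INR; field; lra).
  apply is_RInt_comp_lin in H.
  apply (is_RInt_scal_R _ _ _ (/ N)) in H.
  replace (c / N) with (/ N * c) by (field; lra).
  eapply is_RInt_ext; [|exact H].
  intros x _; unfold scal; simpl; unfold mult; simpl.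
  replace ((INR i + (N * x + - INR i)) / N) with x by (field; lra).
  rewrite <- Rmult_assoc, Rinv_l by lra; apply Rmult_1_l.
Qed.

Lemma is_RInt_cells (f : R -> R) n c :
  (forall i, (i <= n)%nat -> is_RInt (fun s => f ((INR i + s) / INR (S n))) 0 1 (c i)) ->
  is_RInt f 0 1 (sum_f_R0 c n / INR (S n)).
Proof.
  intro H; assert (HN := INR_S_pos n).
  assert (Hm : forall m, (m <= n)%nat ->
    is_RInt f 0 (INR (S m) / INR (S n)) (sum_f_R0 c m / INR (S n))).
  { induction m as [|m IH]; intro Hm.
    - replace 0 with (INR 0 / INR (S n)) by (simpl (INR 0); field; lra).
      apply is_RInt_cell, H, Hm.
    - rewrite tech5, Rdiv_plus_distr.
      apply (is_RInt_Chasles f 0 (INR (S m) / INR (S n))); [apply IH; lia|].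
      apply is_RInt_cell, H, Hm. }
  specialize (Hm n (le_n n)).
  replace (INR (S n) / INR (S n)) with 1 in Hm by (field; lra); exact Hm.
Qed.

Lemma L2ip_cells f g n :
  cts f -> cts g ->
  L2ip f g = sum_f_R0 (fun i => L2ip (fun s => f ((INR i + s) / INR (S n)))
                                  (fun s => g ((INR i + s) / INR (S n)))) n / INR (S n).
Proof.
  intros Hf Hg; apply (@is_RInt_unique R_CompleteNormedModule).
  apply is_RInt_cells; intros i _.
  apply (RInt_cts (fun s => f ((INR i + s) / INR (S n)) * g ((INR i + s) / INR (S n)))); cts_tac.
Qed.

(** Collects the polynomials of the finitely many cells into one function, without a choice
    axiom. *)
Lemma finite_choice {A : Type} (P : nat -> A -> Prop) n :
  (forall i, (i <= n)%nat -> exists x, P i x) ->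
  exists f, forall i, (i <= n)%nat -> P i (f i).
Proof.
  induction n as [|n IH]; intro H.
  - destruct (H 0%nat (le_n 0)) as [x Hx]; exists (fun _ => x); intros i Hi.
    replace i with 0%nat by lia; exact Hx.
  - destruct IH as [f Hf]; [intros i Hi; apply H; lia|].
    destruct (H (S n) (le_n _)) as [x Hx].
    exists (fun i => if Nat.eq_dec i (S n) then x else f i); intros i Hi.
    destruct (Nat.eq_dec i (S n)) as [->|]; [exact Hx | apply Hf; lia].
Qed.

Lemma Vhk_cts N k f : Vhk N k f -> cts f.
Proof. intros [[_ H] _]; exact H. Qed.

Lemma Vhk_cells n k f :
  Vhk (S n) k f ->
  exists W : nat -> R -> R, forall i, (i <= n)%nat ->
    ispoly k (W i) /\ forall s, 0 <= s <= 1 -> f ((INR i + s) / INR (S n)) = W i s.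
Proof.
  intros [_ H].
  apply (finite_choice (fun i W => ispoly k W /\
    forall s, 0 <= s <= 1 -> f ((INR i + s) / INR (S n)) = W s)); intros i Hi.
  assert (HN := INR_S_pos n).
  (* Cells are counted from 0 here and from 1 in [Vhk]. *)
  destruct (H (S i)) as [c Hc]; [lia|].
  exists (fun s => poly_eval c k (/ INR (S n) * s + INR i / INR (S n))); split.
  - apply ispoly_affine; exists c; reflexivity.
  - intros s Hs; replace (/ INR (S n) * s + INR i / INR (S n))
      with ((INR i + s) / INR (S n)) by (field; lra).
    apply Hc; replace (S i - 1)%nat with i by lia; rewrite (S_INR i).
    split; apply Rmult_le_compat_r; try lra; left; apply Rinv_0_lt_compat, HN.
Qed.

Lemma Vhk_of_cells n k f (W : nat -> R -> R) :
  Cp f ->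
  (forall i, (i <= n)%nat ->
    ispoly k (W i) /\ forall s, 0 <= s <= 1 -> f ((INR i + s) / INR (S n)) = W i s) ->
  Vhk (S n) k f.
Proof.
  intros Hf HW; split; [exact Hf|]; intros j Hj.
  assert (HN := INR_S_pos n).
  destruct j as [|i]; [lia|]; destruct (HW i) as [Hp He]; [lia|].
  destruct (ispoly_affine _ _ (INR (S n)) (- INR i) Hp) as [c Hc].
  exists c; intros x Hx; rewrite <- Hc, <- He.
  - f_equal; field; lra.
  - replace (S i - 1)%nat with i in Hx by lia; rewrite (S_INR i) in Hx.
    destruct Hx as [H1 H2].
    apply (Rmult_le_compat_l (INR (S n))) in H1; [|lra].
    apply (Rmult_le_compat_l (INR (S n))) in H2; [|lra].
    replace (INR (S n) * (INR i / INR (S n))) with (INR i) in H1 by (field; lra).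
    replace (INR (S n) * ((INR i + 1) / INR (S n))) with (INR i + 1) in H2 by (field; lra).
    lra.
Qed.

Lemma Vhk_lin n k f g a b :
  Vhk (S n) k f -> Vhk (S n) k g -> Vhk (S n) k (fun x => a * f x + b * g x).
Proof.
  intros Hf Hg.
  destruct (Vhk_cells _ _ _ Hf) as [F HF]; destruct (Vhk_cells _ _ _ Hg) as [G HG].
  apply (Vhk_of_cells _ _ _ (fun i s => a * F i s + b * G i s)).
  - assert (Hfc := Vhk_cts _ _ _ Hf); assert (Hgc := Vhk_cts _ _ _ Hg).
    split; [|change (cts (fun x => a * f x + b * g x)); cts_tac].
    destruct Hf as [[Hfp _] _]; destruct Hg as [[Hgp _] _]; intro x; rewrite Hfp, Hgp; reflexivity.
  - intros i Hi; destruct (HF i Hi) as [HF1 HF2]; destruct (HG i Hi) as [HG1 HG2]; split.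
    + apply ispoly_lin; assumption.
    + intros s Hs; rewrite HF2, HG2 by exact Hs; reflexivity.
Qed.

(** Indexing the pieces by [Z] turns both neighbours and periods into shifts of the index, so the
    first and last cells need no special treatment. *)
Lemma Vhk_glue n k (g : Z -> R -> R) :
  (forall z, ispoly k (g z)) ->
  (forall z, g z 1 = g (z + 1)%Z 0) ->
  (forall z s, g (z + Z.of_nat (S n))%Z s = g z s) ->
  exists f, Vhk (S n) k f /\
    forall i s, 0 <= s <= 1 -> f ((INR i + s) / INR (S n)) = g (Z.of_nat i) s.
Proof.
  intros Hp Hm Hper; assert (HN := INR_S_pos n); set (N := INR (S n)) in *.
  set (f := fun x => g (Int_part (N * x)) (N * x - IZR (Int_part (N * x)))).
  (* The integer part selects the cell to the right of a node; by the matching condition the piece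
     on the left gives the same value there. *)
  assert (Hf : forall z x, IZR z <= N * x <= IZR z + 1 -> f x = g z (N * x - IZR z)).
  { intros z x Hx; unfold f.
    destruct (Rlt_dec (N * x) (IZR z + 1)) as [Hl|Hl].
    - rewrite <- (Int_part_spec (N * x) z) by lra; reflexivity.
    - assert (E : N * x = IZR z + 1) by lra.
      rewrite <- (Int_part_spec (N * x) (z + 1)) by (rewrite plus_IZR; lra).
      rewrite plus_IZR, E.
      replace (IZR z + 1 - (IZR z + 1)) with 0 by ring.
      replace (IZR z + 1 - IZR z) with 1 by ring; symmetry; apply Hm. }
  assert (Hcell : forall i s, 0 <= s <= 1 -> f ((INR i + s) / N) = g (Z.of_nat i) s).
  { intros i s Hs.
    assert (E : N * ((INR i + s) / N) = INR i + s) by (field; lra).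
    rewrite (Hf (Z.of_nat i)); rewrite E, <- INR_IZR_INZ; [f_equal; ring | lra]. }
  exists f; split; [|exact Hcell].
  apply (Vhk_of_cells _ _ _ (fun i => g (Z.of_nat i))); [|intros i _; split; auto].
  split.
  - intro x; destruct (base_Int_part (N * x)) as [H1 H2].
    rewrite (Hf (Int_part (N * x) + Z.of_nat (S n))%Z), (Hf (Int_part (N * x)));
      rewrite ?plus_IZR, <- ?INR_IZR_INZ; fold N; try lra.
    rewrite Hper; f_equal; ring.
  - intro x; destruct (base_Int_part (N * x)) as [H1 H2]; set (z := Int_part (N * x)) in *.
    assert (Hgc : forall y, cts (g y)) by (intro; eapply ispoly_cts, Hp).
    (* Around [x] both cells meeting at [z / N] are covered by one continuous formula:
       [N y] is clamped from above by [z] in the left cell and from below in the right one. *)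
    set (lo := fun y => (N * y + IZR z - Rabs (N * y - IZR z)) / 2).
    set (hi := fun y => (N * y + IZR z + Rabs (N * y - IZR z)) / 2).
    assert (Habs : cts (fun y => Rabs (N * y - IZR z))).
    { intro y; apply (continuous_comp (fun y => N * y - IZR z) Rabs);
        [revert y; change (cts (fun y => N * y - IZR z)); cts_tac | apply continuous_Rabs]. }
    assert (Hlo : cts lo) by (unfold lo; cts_tac).
    assert (Hhi : cts hi) by (unfold hi; cts_tac).
    (* On either side of the node one of the two clamped pieces is frozen at the nodal value, which
       [- g z 0] removes. *)
    apply (continuous_ext_loc _
      (fun y => g (z - 1)%Z (lo y - IZR z + 1) + g z (hi y - IZR z) - g z 0)).
    + apply (locally_interval _ x ((IZR z - 1) / N) ((IZR z + 1) / N)); simpl.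
      * apply (Rmult_lt_reg_l N); [exact HN|].
        replace (N * ((IZR z - 1) / N)) with (IZR z - 1) by (field; lra); lra.
      * apply (Rmult_lt_reg_l N); [exact HN|].
        replace (N * ((IZR z + 1) / N)) with (IZR z + 1) by (field; lra); lra.
      * intros y Hy1 Hy2.
        apply (Rmult_lt_compat_l N) in Hy1; [|exact HN].
        apply (Rmult_lt_compat_l N) in Hy2; [|exact HN].
        replace (N * ((IZR z - 1) / N)) with (IZR z - 1) in Hy1 by (field; lra).
        replace (N * ((IZR z + 1) / N)) with (IZR z + 1) in Hy2 by (field; lra).
        unfold lo, hi; destruct (Rle_dec (IZR z) (N * y)) as [Hz|Hz].
        -- rewrite Rabs_pos_eq by lra; rewrite (Hf z) by lra.
           replace ((N * y + IZR z - (N * y - IZR z)) / 2 - IZR z + 1) with 1 by field.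
           rewrite Hm; replace (z - 1 + 1)%Z with z by ring.
           replace ((N * y + IZR z + (N * y - IZR z)) / 2 - IZR z) with (N * y - IZR z) by field.
           ring.
        -- rewrite Rabs_left by lra; rewrite (Hf (z - 1)%Z) by (rewrite minus_IZR; lra).
           replace ((N * y + IZR z - - (N * y - IZR z)) / 2 - IZR z + 1)
             with (N * y - IZR (z - 1)) by (rewrite minus_IZR; field).
           replace ((N * y + IZR z + - (N * y - IZR z)) / 2 - IZR z) with 0 by field.
           ring.
    + assert (H := Hgc (z - 1)%Z); assert (H' := Hgc z).
      match goal with |- continuous ?F _ => assert (HF : cts F) by cts_tac end.
      apply HF.
Qed.

(** * The piecewise derivative and integration by parts on the mesh *)

Lemma sum_telescope F n :
  sum_f_R0 (fun i => F (S i) - F i) n = F (S n) - F 0%nat.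
Proof. induction n as [|n IH]; [reflexivity | rewrite tech5, IH; ring]. Qed.

Lemma is_RInt_L2ip f g : cts f -> cts g -> is_RInt (fun x => f x * g x) 0 1 (L2ip f g).
Proof. intros Hf Hg; apply RInt_cts; cts_tac. Qed.

Lemma is_RInt_uniq (f : R -> R) a b (l m : R) : is_RInt f a b l -> is_RInt f a b m -> l = m.
Proof.
  intros Hl Hm; apply (@is_RInt_unique R_CompleteNormedModule) in Hl, Hm.
  exact (eq_trans (eq_sym Hl) Hm).
Qed.

Lemma L2ip_by_parts f df g dg :
  (forall x, is_derive f x (df x)) -> (forall x, is_derive g x (dg x)) ->
  cts df -> cts dg ->
  L2ip df g = f 1 * g 1 - f 0 * g 0 - L2ip f dg.
Proof.
  intros Hf Hg Hdf Hdg.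
  assert (Hfc : cts f).
  { intro x; apply (@ex_derive_continuous R_AbsRing R_NormedModule); eexists; apply Hf. }
  assert (Hgc : cts g).
  { intro x; apply (@ex_derive_continuous R_AbsRing R_NormedModule); eexists; apply Hg. }
  assert (H : is_RInt (fun x => df x * g x + f x * dg x) 0 1 (f 1 * g 1 - f 0 * g 0)).
  { apply (is_RInt_derive (fun x => f x * g x)).
    - intros x _; apply (is_derive_mult f g); [apply Hf | apply Hg | intros; apply Rmult_comm].
    - intros x _; revert x; change (cts (fun x => df x * g x + f x * dg x)); cts_tac. }
  assert (H' := is_RInt_L2ip df g Hdf Hgc).
  assert (H'' := is_RInt_L2ip f dg Hfc Hdg).
  assert (E := is_RInt_uniq _ _ _ _ _ H (is_RInt_plus_R _ _ _ _ _ _ H' H'')).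
  rewrite E; ring.
Qed.

Definition is_C1 (u : R -> R) : Prop := (forall x, ex_derive u x) /\ cts (Derive u).

Lemma is_derive_cell (f : R -> R) (df N i s : R) :
  N <> 0 -> is_derive f ((i + s) / N) df -> is_derive (fun t => f ((i + t) / N)) s (df / N).
Proof.
  intros HN Hf.
  replace (df / N) with (scal (/ N) df) by (unfold scal; simpl; unfold mult; simpl; field; exact HN).
  apply (is_derive_comp f (fun t => (i + t) / N)); [exact Hf|].
  auto_derive; [trivial | field; exact HN].
Qed.

(** Only interior points are covered, since [f] may have a kink at a node; near such a point [f] is
    [p] composed with [N y - i], whence the factor [N]. *)
Lemma dx_diff_cell n k f p u i s :
  is_C1 u -> ispoly k p -> 0 < s < 1 ->
  (forall t, 0 <= t <= 1 -> f ((INR i + t) / INR (S n)) = p t) ->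
  dx_diff f u ((INR i + s) / INR (S n))
  = INR (S n) * Derive p s - Derive u ((INR i + s) / INR (S n)).
Proof.
  intros [Hu _] Hp Hs Hf; assert (HN := INR_S_pos n); set (N := INR (S n)) in *.
  set (x := (INR i + s) / N).
  assert (HNx : N * x - INR i = s) by (unfold x; field; lra).
  apply is_derive_unique.
  apply (is_derive_minus f u); [|apply Derive_correct, Hu].
  apply (is_derive_ext_loc (fun y => p (N * y - INR i))).
  - apply (locally_interval _ x (INR i / N) ((INR i + 1) / N)); simpl.
    + apply Rmult_lt_compat_r; [apply Rinv_0_lt_compat, HN | lra].
    + apply Rmult_lt_compat_r; [apply Rinv_0_lt_compat, HN | lra].
    + intros y H1 H2.
      apply (Rmult_lt_compat_l N) in H1; [|exact HN].
      apply (Rmult_lt_compat_l N) in H2; [|exact HN].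
      replace (N * (INR i / N)) with (INR i) in H1 by (field; lra).
      replace (N * ((INR i + 1) / N)) with (INR i + 1) in H2 by (field; lra).
      rewrite <- Hf by lra; f_equal; field; lra.
  - apply (is_derive_comp p (fun y => N * y - INR i)).
    + rewrite HNx; apply Derive_correct, (ispoly_ex_derive k), Hp.
    + auto_derive; [trivial | ring].
Qed.

Lemma is_RInt_dx_diff n k f u g (P G : nat -> R -> R) :
  is_C1 u ->
  (forall i, (i <= n)%nat ->
    ispoly k (P i) /\ forall s, 0 <= s <= 1 -> f ((INR i + s) / INR (S n)) = P i s) ->
  (forall i, (i <= n)%nat ->
    ispoly k (G i) /\ forall s, 0 <= s <= 1 -> g ((INR i + s) / INR (S n)) = G i s) ->
  is_RInt (fun x => dx_diff f u x * g x) 0 1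
    (sum_f_R0 (fun i =>
       L2ip (fun s => INR (S n) * Derive (P i) s - Derive u ((INR i + s) / INR (S n))) (G i)) n
     / INR (S n)).
Proof.
  intros Hu HP HG; apply is_RInt_cells; intros i Hi.
  destruct (HP i Hi) as [HPp HPe]; destruct (HG i Hi) as [HGp HGe].
  apply (is_RInt_ext (fun s =>
    (INR (S n) * Derive (P i) s - Derive u ((INR i + s) / INR (S n))) * G i s)).
  - intros s; rewrite Rmin_left, Rmax_right by lra; intro Hs.
    rewrite (dx_diff_cell n k f (P i) u i s) by assumption.
    rewrite HGe by lra; reflexivity.
  - destruct Hu as [_ Hu]; assert (H1 := ispoly_cts _ _ (ispoly_Derive _ _ HPp)).
    assert (H2 := ispoly_cts _ _ HGp).
    apply RInt_cts; cts_tac.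
Qed.

(** Integrability is a hypothesis because [RInt] is total and additive only on integrable functions,
    while the [d] of interest may jump at the nodes. *)
Lemma L2proj_dx_diff N k d w g :
  is_L2proj N k d w -> Vhk N k g -> ex_RInt (fun x => d x * g x) 0 1 ->
  L2ip w g = RInt (fun x => d x * g x) 0 1.
Proof.
  intros [Hw H] Hg Hex; specialize (H g Hg).
  assert (Hwc := Vhk_cts _ _ _ Hw); assert (Hgc := Vhk_cts _ _ _ Hg).
  assert (E : is_RInt (fun x => (d x - w x) * g x) 0 1
                (RInt (fun x => d x * g x) 0 1 + (-1) * L2ip w g)).
  { apply (is_RInt_ext (fun x => d x * g x + (-1) * (w x * g x))).
    - intros x _; simpl; ring.
    - apply is_RInt_plus_R.
      + apply (@RInt_correct R_CompleteNormedModule), Hex.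
      + apply is_RInt_scal_R, is_RInt_L2ip; assumption. }
  assert (H0 : is_RInt (fun x => (d x - w x) * g x) 0 1
                 (L2ip (fun x => d x - w x) g)).
  { apply (@RInt_correct R_CompleteNormedModule); eexists; exact E. }
  assert (E' := is_RInt_uniq _ _ _ _ _ E H0); lra.
Qed.

(** * Taylor expansion and the quasi-interpolant *)

Lemma taylor_bound m u M x t :
  (forall j y, (j < S m)%nat -> ex_derive (Derive_n u j) y) ->
  (forall y, Rabs (Derive_n u (S m) y) <= M) -> 0 < t ->
  Rabs (u (x + t) - sum_f_R0 (fun j => t ^ j / INR (fact j) * Derive_n u j x) m)
  <= t ^ S m * M.
Proof.
  intros Hd HM Ht.
  destruct (Taylor_Lagrange u m x (x + t)) as (zeta & _ & E); [lra| |].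
  { intros y _ [|j] Hj; [exact I | apply Hd; lia]. }
  rewrite E; replace (x + t - x) with t by ring.
  match goal with |- Rabs (?a + ?b - ?c) <= _ => replace (a + b - c) with b by ring end.
  assert (Hf : 1 <= INR (fact (S m))) by (apply (le_INR 1), lt_O_fact).
  assert (Htm : 0 < t ^ S m) by (apply pow_lt, Ht).
  rewrite Rabs_mult, (Rabs_pos_eq (_ / _)) by (apply Rdiv_le_0_compat; lra).
  apply Rmult_le_compat; [apply Rdiv_le_0_compat; lra | apply Rabs_pos | | apply HM].
  apply (Rmult_le_reg_r (INR (fact (S m)))); [lra|].
  unfold Rdiv; rewrite Rmult_assoc, Rinv_l by lra; nra.
Qed.

Lemma poly_eval_0 c k : poly_eval c k 0 = c 0%nat.
Proof.
  unfold poly_eval; induction k as [|k IH]; [simpl; ring|].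
  rewrite tech5, IH, pow_i by lia; ring.
Qed.

Lemma Cpm_is_C1 m u : Cpm (S m) u -> is_C1 u.
Proof.
  intros (_ & Hd & Hc); split.
  - intro x; apply (Hd 0%nat x); lia.
  - destruct (Hc 1%nat) as [_ H]; [lia | exact H].
Qed.

Lemma is_derive_cts f df : (forall x, is_derive f x (df x)) -> cts f.
Proof.
  intros H x; apply (@ex_derive_continuous R_AbsRing R_NormedModule); exists (df x); apply H.
Qed.

Lemma periodic1_INR f i : periodic1 f -> f (INR i) = f 0.
Proof.
  intro H; induction i as [|i IH]; [reflexivity | rewrite S_INR, H; exact IH].
Qed.

(* Summing integration by parts over the cells: the boundary terms telescope and cancel by
   periodicity. *)
Lemma dx_diff_by_parts n k f u g (P G : nat -> R -> R) :
  is_C1 u -> periodic1 u -> Vhk (S n) k f -> Vhk (S n) k g ->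
  (forall i, (i <= n)%nat ->
    ispoly k (P i) /\ forall s, 0 <= s <= 1 -> f ((INR i + s) / INR (S n)) = P i s) ->
  (forall i, (i <= n)%nat ->
    ispoly k (G i) /\ forall s, 0 <= s <= 1 -> g ((INR i + s) / INR (S n)) = G i s) ->
  is_RInt (fun x => dx_diff f u x * g x) 0 1
    (sum_f_R0 (fun i => L2ip (fun s => u ((INR i + s) / INR (S n)) - P i s)
                             (Derive (G i))) n).
Proof.
  intros Hu Hup Hf Hg HP HG; assert (HN := INR_S_pos n).
  assert (H := is_RInt_dx_diff n k f u g P G Hu HP HG).
  set (N := INR (S n)) in *.
  set (B := fun i => (f (INR i / N) - u (INR i / N)) * g (INR i / N)).
  assert (E : sum_f_R0 (fun i =>
       L2ip (fun s => N * Derive (P i) s - Derive u ((INR i + s) / N)) (G i)) n / N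
     = sum_f_R0 (fun i => B (S i) - B i) n +
       sum_f_R0 (fun i => L2ip (fun s => u ((INR i + s) / N) - P i s) (Derive (G i))) n).
  { rewrite <- plus_sum; rewrite Rdiv_def, Rmult_comm, scal_sum; apply sum_eq; intros i Hi.
    destruct (HP i Hi) as [HPp HPe]; destruct (HG i Hi) as [HGp HGe].
    destruct Hu as [Hud Hu].
    assert (HdP := ispoly_cts _ _ (ispoly_Derive _ _ HPp)).
    assert (HdG := ispoly_cts _ _ (ispoly_Derive _ _ HGp)).
    assert (HPc := ispoly_cts _ _ HPp); assert (HGc := ispoly_cts _ _ HGp).
    assert (Huc : cts u).
    { apply (is_derive_cts u (Derive u)); intro x; apply Derive_correct, Hud. }
    set (th := fun s => P i s - u ((INR i + s) / N)).
    set (dth := fun s => Derive (P i) s - Derive u ((INR i + s) / N) / N).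
    assert (Hbp : L2ip dth (G i) = th 1 * G i 1 - th 0 * G i 0 - L2ip th (Derive (G i))).
    { apply L2ip_by_parts.
      - intro x; apply (is_derive_minus (P i)); [apply Derive_correct, (ispoly_ex_derive k), HPp|].
        apply is_derive_cell; [lra | apply Derive_correct, Hud].
      - intro x; apply Derive_correct, (ispoly_ex_derive k), HGp.
      - unfold dth; cts_tac.
      - exact HdG. }
    (* The factor [N] extracted here cancels the cell length [1 / N], so the resulting sum carries
       no weight. *)
    rewrite (L2ip_ext (fun s => N * Derive (P i) s - Derive u ((INR i + s) / N))
               (fun s => N * dth s + 0 * 0) (G i) (G i)) by
      (intro; unfold dth; try field; lra).
    rewrite (L2ip_ext (fun s => u ((INR i + s) / N) - P i s) (fun s => (-1) * th s + 0 * 0)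
               (Derive (G i)) (Derive (G i))) by (intro; unfold th; ring).
    rewrite !L2ip_lin_l by (unfold dth, th; cts_tac).
    rewrite Hbp; unfold th at 1 2; rewrite <- !HPe, <- !HGe by lra.
    unfold B; rewrite S_INR, Rplus_0_r.
    replace (/ N) with (1 / N) by (field; lra); field; lra. }
  rewrite E, sum_telescope in H.
  replace (B (S n) - B 0%nat) with 0 in H; [rewrite Rplus_0_l in H; exact H|].
  destruct Hf as [[Hfp _] _]; destruct Hg as [[Hgp _] _].
  unfold B; fold N; replace (N / N) with (INR 1) by (simpl; field; lra).
  replace (INR 0 / N) with 0 by (simpl; field; lra).
  rewrite (periodic1_INR f 1), (periodic1_INR u 1), (periodic1_INR g 1) by assumption; ring.
Qed.

(** Expand the square of [a f - g] and divide by [2 a]. *)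
Lemma L2ip_young f g a :
  cts f -> cts g -> 0 < a -> L2ip f g <= a / 2 * L2ip f f + / (2 * a) * L2ip g g.
Proof.
  intros Hf Hg Ha.
  assert (H := L2ip_ge_0 (fun x => a * f x + (-1) * g x)).
  rewrite L2ip_sq_lin in H by assumption.
  assert (Hc : cts (fun x => a * f x + -1 * g x)) by cts_tac.
  specialize (H Hc).
  apply (Rmult_le_reg_l (2 * a)); [lra|].
  replace (2 * a * (a / 2 * L2ip f f + / (2 * a) * L2ip g g))
    with (a ^ 2 * L2ip f f + L2ip g g) by (field; lra).
  lra.
Qed.

Lemma L2ip_sq_le f b : cts f -> 0 <= b -> (forall x, 0 < x < 1 -> Rabs (f x) <= b) ->
  L2ip f f <= b ^ 2.
Proof.
  intros Hf Hb H.
  replace (b ^ 2) with ((1 - 0) * b ^ 2) by ring; rewrite <- RInt_const_R.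
  apply RInt_le; [lra | apply cts_ex_RInt; cts_tac | apply cts_ex_RInt; cts_tac |].
  intros x Hx; specialize (H x Hx); apply Rabs_le_between in H; nra.
Qed.

Lemma L2norm_le w b : 0 <= b -> L2ip w w <= b ^ 2 -> L2norm w <= b.
Proof.
  intros Hb H; unfold L2norm; rewrite <- (sqrt_pow2 b) by exact Hb.
  apply sqrt_le_1_alt, H.
Qed.

(* [e = x^(k+1) - q] is orthogonal to polynomials of degree at most [k] and [e 0 = e 1], so the
   Taylor expansions minus [a z * e] can be glued into a finite element function with corrections
   of the order of the Taylor remainder. *)
Lemma quasi_interpolant k q u n M :
  ispoly k q -> 1 - q 1 = - q 0 -> (1 <= k)%nat ->
  Cpm (S (S k)) u -> (forall x, Rabs (Derive_n u (S (S k)) x) <= M) ->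
  exists (f : R -> R) (a : nat -> R), Vhk (S n) k f /\
    forall i s, 0 < s < 1 ->
      Rabs (u ((INR i + s) / INR (S n)) - f ((INR i + s) / INR (S n)) - a i * (s ^ S k - q s))
      <= (2 + Rabs (q 0)) * (/ INR (S n)) ^ S (S k) * M.
Proof.
  intros Hq Hq01 Hk (_ & Hd & Hc) HM.
  assert (HN := INR_S_pos n); set (N := INR (S n)) in *.
  (* Taylor coefficients at the node [z / N] in the local variable [s]; [a] is the leading one and
     [r] the remainder at the right end of the cell. *)
  set (c := fun (z : Z) j => Derive_n u j (IZR z / N) / (N ^ j * INR (fact j))).
  set (a := fun z => c z (S k)).
  set (r := fun z => u ((IZR z + 1) / N) - poly_eval (c z) (S k) 1).
  (* The slope that makes the piece end at [u ((z + 1) / N) + a (z + 1) * q 0], the starting value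
     of the next one. In [g] the top-degree term has cancelled: the Taylor polynomial minus
     [a z * e] is its part of degree [k] plus [a z * q]. *)
  set (d := fun z => r z + (a (z + 1)%Z - a z) * q 0).
  set (g := fun z s => 1 * poly_eval (c z) k s + 1 * (a z * q s + d z * s)).
  set (B := (/ N) ^ S (S k) * M).
  assert (HM0 : 0 <= M) by (eapply Rle_trans; [apply Rabs_pos | apply (HM 0)]).
  assert (HiN : 0 < / N) by (apply Rinv_0_lt_compat, HN).
  assert (HB : 0 <= B) by (apply Rmult_le_pos; [apply pow_le; lra | exact HM0]).
  assert (Htay : forall z s, 0 < s <= 1 ->
    Rabs (u ((IZR z + s) / N) - poly_eval (c z) (S k) s) <= B).
  { intros z s Hs.
    assert (Hs' : 0 < s / N) by (apply Rdiv_lt_0_compat; lra).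
    assert (H := taylor_bound (S k) u M (IZR z / N) (s / N) Hd HM Hs').
    replace (IZR z / N + s / N) with ((IZR z + s) / N) in H by (field; lra).
    replace (poly_eval (c z) (S k) s) with
      (sum_f_R0 (fun j => (s / N) ^ j / INR (fact j) * Derive_n u j (IZR z / N)) (S k)).
    - eapply Rle_trans; [exact H|].
      apply Rmult_le_compat_r; [exact HM0|].
      apply pow_incr; split; [lra|]; unfold Rdiv; nra.
    - apply sum_eq; intros j _; unfold c.
      assert (Hf := INR_fact_neq_0 j).
      unfold Rdiv; rewrite Rpow_mult_distr, pow_inv by lra; field.
      split; [exact Hf | apply pow_nonzero; lra]. }
  (* The mean value theorem for the derivative of order [k + 1] over one cell gains one more power
     of the mesh size. *)
  assert (Ha : forall z, Rabs (a (z + 1)%Z - a z) <= B).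
  { intro z; unfold a, c.
    destruct (MVT_gen (Derive_n u (S k)) (IZR z / N) (IZR (z + 1) / N) (Derive_n u (S (S k))))
      as (xi & _ & E).
    - intros x _; apply (Derive_correct (Derive_n u (S k))), Hd; lia.
    - intros x _; apply continuity_pt_filterlim.
      apply (@ex_derive_continuous R_AbsRing R_NormedModule), Hd; lia.
    - assert (Hf : 1 <= INR (fact (S k))) by (apply (le_INR 1), lt_O_fact).
      assert (HNk : 0 < N ^ S k) by (apply pow_lt, HN).
      match goal with |- Rabs ?y <= _ =>
        replace y with ((/ N) ^ S (S k) * (/ INR (fact (S k)) * Derive_n u (S (S k)) xi)) end.
      + unfold B; rewrite !Rabs_mult, (Rabs_pos_eq ((/ N) ^ S (S k))) by (apply pow_le; lra).
        apply Rmult_le_compat_l; [apply pow_le; lra|].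
        rewrite Rabs_pos_eq by (left; apply Rinv_0_lt_compat; lra).
        apply Rle_trans with (1 * Rabs (Derive_n u (S (S k)) xi)); [|rewrite Rmult_1_l; apply HM].
        apply Rmult_le_compat_r; [apply Rabs_pos|].
        rewrite <- Rinv_1; apply Rinv_le_contravar; lra.
      + rewrite plus_IZR in *.
        replace ((IZR z + 1) / N - IZR z / N) with (/ N) in E by (field; lra).
        unfold Rdiv at 1 3; rewrite <- Rmult_minus_distr_r, E.
        change ((/ N) ^ S (S k)) with (/ N * (/ N) ^ S k).
        rewrite pow_inv, Rinv_mult; ring. }
  assert (Hr : forall z, Rabs (r z) <= B) by (intro z; apply Htay; lra).
  (* Adding the Taylor remainder, at most [B], gives the constant [2 + Rabs (q 0)]. *)
  assert (HdB : forall z, Rabs (d z) <= (1 + Rabs (q 0)) * B).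
  { intro z; unfold d; eapply Rle_trans; [apply Rabs_triang|].
    rewrite Rabs_mult; specialize (Hr z); specialize (Ha z).
    assert (H0 := Rabs_pos (q 0)); nra. }
  destruct (Vhk_glue n k g) as (f & Hf & Hfg).
  - intro z; apply ispoly_lin; [exists (c z); reflexivity|].
    apply (ispoly_lin _ q (fun s => s)); [exact Hq|].
    destruct k as [|k]; [lia|].
    apply (ispoly_ext _ (fun s => s * 1)); [intro; ring|].
    apply ispoly_mult_id, ispoly_const.
  - intro z; unfold g; rewrite poly_eval_0.
    assert (E : c (z + 1)%Z 0%nat = u ((IZR z + 1) / N)).
    { unfold c; rewrite plus_IZR; simpl; field; lra. }
    rewrite E; unfold d, r.
    replace (poly_eval (c z) (S k) 1) with (poly_eval (c z) k 1 + a z)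
      by (unfold poly_eval; rewrite tech5, pow1, Rmult_1_r; reflexivity).
    replace (q 1) with (1 + q 0) by lra; ring.
  - intros z s.
    assert (Ec : forall y j, (j <= S k)%nat -> c (y + Z.of_nat (S n))%Z j = c y j).
    { intros y j Hj; unfold c; rewrite plus_IZR, <- INR_IZR_INZ; fold N.
      destruct (Hc j) as [Hper _]; [lia|].
      replace ((IZR y + N) / N) with (IZR y / N + 1) by (field; lra).
      rewrite Hper; reflexivity. }
    assert (Er : r (z + Z.of_nat (S n))%Z = r z).
    { unfold r; f_equal.
      - destruct (Hc 0%nat) as [Hper _]; [lia|].
        rewrite plus_IZR, <- INR_IZR_INZ; fold N.
        replace ((IZR z + N + 1) / N) with ((IZR z + 1) / N + 1) by (field; lra).
        apply Hper.
      - apply sum_eq; intros j Hj; rewrite Ec by exact Hj; reflexivity. }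
    unfold g, d; rewrite Er; unfold a.
    replace (z + Z.of_nat (S n) + 1)%Z with ((z + 1) + Z.of_nat (S n))%Z by ring.
    rewrite !Ec by lia.
    replace (poly_eval (c (z + Z.of_nat (S n))%Z) k s) with (poly_eval (c z) k s); [reflexivity|].
    apply sum_eq; intros j Hj; rewrite Ec by lia; reflexivity.
  - exists f, (fun i => a (Z.of_nat i)); split; [exact Hf|].
    intros i s Hs; fold N in Hfg; rewrite Hfg by lra.
    rewrite INR_IZR_INZ; set (z := Z.of_nat i).
    replace (u ((IZR z + s) / N) - g z s - a z * (s ^ S k - q s))
      with ((u ((IZR z + s) / N) - poly_eval (c z) (S k) s) + - (d z * s)).
    + eapply Rle_trans; [apply Rabs_triang|].
      rewrite Rabs_Ropp, Rabs_mult, (Rabs_pos_eq s) by lra.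
      specialize (HdB z); specialize (Htay z s ltac:(lra)).
      assert (H0 := Rabs_pos (d z)); fold B in Htay.
      rewrite Rmult_assoc; fold B; nra.
    + unfold g, poly_eval; rewrite tech5; unfold a; ring.
Qed.

(** * The estimate for odd degree *)

Lemma sum_scal_r F c n : sum_f_R0 (fun i => F i * c) n = c * sum_f_R0 F n.
Proof. symmetry; apply scal_sum. Qed.

(** [M] is any pointwise bound on the top derivative; taking the sup norm for it gives the usual
    form without constructing a supremum. *)
Lemma estimate_odd k :
  (1 <= k)%nat -> Nat.Even (S k) ->
  exists C : R, 0 < C /\
    forall u, Cpm (S (S k)) u ->
    forall n M, (forall x, Rabs (Derive_n u (S (S k)) x) <= M) ->
    forall Pu w, is_L2proj (S n) k u Pu -> is_L2proj (S n) k (dx_diff Pu u) w ->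
    L2norm w <= C * (/ INR (S n)) ^ S k * M.
Proof.
  intros Hk Hev.
  destruct (legendre_even k Hev) as (q & Hq & Hort & Hq01).
  destruct (inverse_inequality k) as (K & HK & Hinv).
  assert (Hq0 := Rabs_pos (q 0)).
  assert (HsK : 0 < sqrt K) by (apply sqrt_lt_R0, HK).
  exists (sqrt K * (2 + Rabs (q 0))); split; [apply Rmult_lt_0_compat; lra|].
  intros u Hu n M HM Pu w [HPu HPo] [Hw Hwo].
  assert (HM0 : 0 <= M) by (eapply Rle_trans; [apply Rabs_pos | apply (HM 0)]).
  assert (HN := INR_S_pos n).
  destruct (quasi_interpolant k q u n M Hq Hq01 Hk Hu HM) as (f & a & Hf & Hrho).
  destruct (Vhk_cells _ _ _ HPu) as [P HP].
  destruct (Vhk_cells _ _ _ Hw) as [W HW].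
  destruct (Vhk_cells _ _ _ Hf) as [F HF].
  assert (Hu1 := Cpm_is_C1 _ _ Hu).
  destruct Hu as [[Hup Huc] _]; change (cts u) in Huc.
  assert (HPc := Vhk_cts _ _ _ HPu); assert (Hfc := Vhk_cts _ _ _ Hf).
  assert (Hwc := Vhk_cts _ _ _ Hw).
  assert (Hqc := ispoly_cts _ _ Hq).
  set (N := INR (S n)) in *.
  set (b := (2 + Rabs (q 0)) * (/ N) ^ S (S k) * M) in *.
  assert (Hb : 0 <= b).
  { apply Rmult_le_pos; [apply Rmult_le_pos; [lra|] | exact HM0].
    apply pow_le; left; apply Rinv_0_lt_compat, HN. }
  set (e := fun s => s ^ S k - q s) in *.
  assert (Hec : cts e) by (unfold e; cts_tac).
  (* [H] is the projection error minus the multiple of [e], [V] is [Pu - f], and their sum [rho] is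
     the error of the quasi-interpolant, bounded by [b]. *)
  set (H := fun i s => 1 * (u ((INR i + s) / N) - Pu ((INR i + s) / N)) + (- a i) * e s).
  set (V := fun i s => 1 * Pu ((INR i + s) / N) + (-1) * f ((INR i + s) / N)).
  set (rho := fun i s => 1 * H i s + 1 * V i s).
  assert (HHc : forall i, cts (H i)) by (intro; unfold H; cts_tac).
  assert (HVc : forall i, cts (V i)) by (intro; unfold V; cts_tac).
  assert (Hrc : forall i, cts (rho i)).
  { intro i; unfold rho; assert (H1 := HHc i); assert (H2 := HVc i); cts_tac. }
  assert (HdW : forall i, (i <= n)%nat -> cts (Derive (W i))).
  { intros i Hi; eapply ispoly_cts, ispoly_Derive, HW, Hi. }
  set (SH := sum_f_R0 (fun i => L2ip (H i) (H i)) n).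
  set (SW := sum_f_R0 (fun i => L2ip (W i) (W i)) n).
  assert (EW : L2ip w w = SW / N).
  { rewrite (L2ip_cells w w n) by assumption; fold N; unfold SW; f_equal.
    apply sum_eq; intros i Hi; destruct (HW i Hi) as [_ HWe].
    apply L2ip_ext_01; intros s Hs; apply HWe; lra. }
  assert (EH : L2ip w w = sum_f_R0 (fun i => L2ip (H i) (Derive (W i))) n).
  { assert (E := dx_diff_by_parts n k Pu u w P W Hu1 Hup HPu Hw HP HW).
    rewrite (L2proj_dx_diff (S n) k (dx_diff Pu u) w w (conj Hw Hwo) Hw)
      by (eexists; exact E).
    transitivity (sum_f_R0 (fun i => L2ip (fun s => u ((INR i + s) / N) - P i s)
                                          (Derive (W i))) n).
    { exact (@is_RInt_unique R_CompleteNormedModule _ _ _ _ E). }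
    apply sum_eq; intros i Hi.
    destruct (HP i Hi) as [_ HPe]; destruct (HW i Hi) as [HWp _].
    unfold H; rewrite L2ip_lin_l; [| cts_tac | assumption | apply HdW, Hi].
    rewrite Hort by (apply ispoly_Derive, HWp).
    rewrite Rmult_0_r, Rplus_0_r, Rmult_1_l.
    apply L2ip_ext_01; intros s Hs; [rewrite HPe by lra|]; reflexivity. }
  (* [u - Pu] is orthogonal to the finite element function [Pu - f], and [e] to its polynomial on
     each cell. By Pythagoras [H] is then no larger than [rho]. *)
  assert (EV : sum_f_R0 (fun i => L2ip (H i) (V i)) n = 0).
  { assert (Eo := HPo _ (Vhk_lin _ _ _ _ 1 (-1) HPu Hf)).
    rewrite (L2ip_cells _ _ n) in Eo by cts_tac; fold N in Eo.
    apply Rmult_integral in Eo; destruct Eo as [Eo|Eo];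
      [|exfalso; revert Eo; apply Rinv_neq_0_compat; lra].
    refine (eq_trans _ Eo); apply sum_eq; intros i Hi.
    destruct (HP i Hi) as [HPp HPe]; destruct (HF i Hi) as [HFp HFe].
    unfold H; rewrite L2ip_lin_l; [| cts_tac | assumption | apply HVc].
    replace (L2ip e (V i)) with 0; [unfold V; ring|].
    rewrite <- (Hort (fun s => 1 * P i s + (-1) * F i s)) by (apply ispoly_lin; assumption).
    apply L2ip_ext_01; intros s Hs; [reflexivity|].
    unfold V; rewrite HPe, HFe by lra; reflexivity. }
  assert (HSH : SH <= N * b ^ 2).
  { apply Rle_trans with (sum_f_R0 (fun i => L2ip (rho i) (rho i)) n).
    - rewrite (sum_eq (fun i => L2ip (rho i) (rho i))
        (fun i => (L2ip (H i) (H i) + L2ip (V i) (V i)) + L2ip (H i) (V i) * 2)).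
      + rewrite !plus_sum, sum_scal_r, EV; fold SH.
        assert (0 <= sum_f_R0 (fun i => L2ip (V i) (V i)) n); [|lra].
        apply cond_pos_sum; intro; apply L2ip_ge_0, HVc.
      + intros i _; unfold rho; rewrite L2ip_sq_lin by auto; ring.
    - replace (N * b ^ 2) with (sum_f_R0 (fun _ => b ^ 2) n)
        by (rewrite sum_cte; apply Rmult_comm).
      apply sum_Rle; intros i _; apply L2ip_sq_le; [apply Hrc | exact Hb |].
      intros s Hs; specialize (Hrho i s Hs); fold (e s) in Hrho.
      replace (rho i s) with (u ((INR i + s) / N) - f ((INR i + s) / N) - a i * e s); [exact Hrho|].
      unfold rho, H, V; ring. }
  assert (Hmain : L2ip w w <= K * N / 2 * SH + / (2 * N) * SW).
  { rewrite EH; unfold SH, SW; rewrite !scal_sum, <- plus_sum; apply sum_Rle; intros i Hi.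
    (* The weight [K * N] is chosen so that, after the inverse inequality, the second terms add up
       to half of [L2ip w w], which is absorbed on the left. *)
    eapply Rle_trans; [apply (L2ip_young _ _ (K * N)); [apply HHc | apply HdW, Hi | nra]|].
    destruct (HW i Hi) as [HWp _]; specialize (Hinv _ HWp).
    rewrite (Rmult_comm (L2ip (H i) (H i))); apply Rplus_le_compat_l.
    apply (Rmult_le_reg_l (2 * (K * N))); [nra|].
    rewrite <- Rmult_assoc, Rinv_r by nra.
    replace (2 * (K * N) * (L2ip (W i) (W i) * / (2 * N))) with (K * L2ip (W i) (W i))
      by (field; lra).
    lra. }
  assert (HSH2 : K * N * SH <= K * N * (N * b ^ 2)) by (apply Rmult_le_compat_l; nra).
  replace (/ (2 * N) * SW) with (L2ip w w / 2) in Hmain by (rewrite EW; field; lra).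
  replace (sqrt K * (2 + Rabs (q 0)) * (/ N) ^ S k * M) with (sqrt K * (N * b)).
  - apply L2norm_le.
    + apply Rmult_le_pos; [lra | apply Rmult_le_pos; lra].
    + rewrite Rpow_mult_distr, pow2_sqrt by lra; nra.
  - unfold b; change ((/ N) ^ S (S k)) with (/ N * (/ N) ^ S k); field; lra.
Qed.

(** * Translation by the mesh size *)

Lemma Vhk_ext n k f g : (forall x, f x = g x) -> Vhk (S n) k f -> Vhk (S n) k g.
Proof.
  intros E Hf; destruct (Vhk_cells _ _ _ Hf) as [F HF].
  destruct Hf as [[Hfp Hfc] _].
  apply (Vhk_of_cells _ _ _ F).
  - split; [intro x; rewrite <- !E; apply Hfp | apply (cts_ext f g E Hfc)].
  - intros i Hi; destruct (HF i Hi) as [Hp He]; split; [exact Hp|].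
    intros s Hs; rewrite <- E; apply He, Hs.
Qed.

Lemma Vhk_shift n k f : Vhk (S n) k f -> Vhk (S n) k (fun x => f (x + / INR (S n))).
Proof.
  intro Hf; destruct (Vhk_cells _ _ _ Hf) as [F HF]; assert (HN := INR_S_pos n).
  destruct Hf as [[Hfp Hfc] _]; change (cts f) in Hfc.
  (* The last cell is carried past 1 and wraps around to the first by periodicity. *)
  apply (Vhk_of_cells _ _ _ (fun i => if Nat.eq_dec i n then F 0%nat else F (S i))).
  - split.
    + intro x; rewrite <- (Hfp (x + / INR (S n))); f_equal; ring.
    + change (cts (fun x => f (x + / INR (S n)))); cts_tac.
  - intros i Hi; destruct (Nat.eq_dec i n) as [->|Hne].
    + destruct (HF 0%nat ltac:(lia)) as [Hp He]; split; [exact Hp|].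
      intros s Hs; rewrite <- He by exact Hs; rewrite <- (Hfp (_ / _)); f_equal.
      rewrite S_INR in *; simpl (INR 0); field; lra.
    + destruct (HF (S i) ltac:(lia)) as [Hp He]; split; [exact Hp|].
      intros s Hs; rewrite <- He by exact Hs; f_equal.
      rewrite (S_INR i); field; lra.
Qed.

(** By periodicity, one step back is [n] steps forward, as [S n] steps make a full period. *)
Lemma Vhk_shift_neg n k f : Vhk (S n) k f -> Vhk (S n) k (fun x => f (x - / INR (S n))).
Proof.
  intro Hf; assert (HN := INR_S_pos n).
  assert (H : forall m, Vhk (S n) k (fun x => f (x + INR m / INR (S n)))).
  { induction m as [|m IH].
    - apply (Vhk_ext _ _ f); [|exact Hf].
      intro x; f_equal; simpl (INR 0); field; lra.
    - apply Vhk_shift in IH; revert IH; apply Vhk_ext.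
      intro x; rewrite (S_INR m); f_equal; field; lra. }
  specialize (H n); revert H; apply Vhk_ext; intro x.
  destruct Hf as [[Hfp _] _]; rewrite <- (Hfp (x - _)); f_equal.
  rewrite S_INR in *; field; lra.
Qed.

(** The integrals over [[0, c]] and [[1, 1 + c]] agree by periodicity; Chasles' relation does the
    rest for either sign of [c]. *)
Lemma RInt_shift (f : R -> R) c :
  periodic1 f -> cts f -> @eq R (RInt (fun x => f (x + c)) 0 1) (RInt f 0 1).
Proof.
  intros Hp Hf.
  assert (Hsh : forall d a b, @eq R (RInt (fun x => f (x + d)) a b) (RInt f (a + d) (b + d))).
  { intros d a b.
    assert (H := RInt_comp_lin f 1 d a b (cts_ex_RInt _ _ _ Hf)).
    rewrite !Rmult_1_l in H; refine (eq_trans _ H).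
    apply RInt_eq; intro x; unfold scal; simpl; unfold mult; simpl.
    rewrite !Rmult_1_l; reflexivity. }
  rewrite Hsh, Rplus_0_l.
  assert (E1 := Hsh 1 0 c).
  rewrite (RInt_eq (fun x => f (x + 1)) f) in E1 by exact Hp.
  rewrite Rplus_0_l, (Rplus_comm c) in E1.
  assert (E2 := RInt_Chasles f 0 c (1 + c) (cts_ex_RInt _ _ _ Hf) (cts_ex_RInt _ _ _ Hf)).
  assert (E3 := RInt_Chasles f 0 1 (1 + c) (cts_ex_RInt _ _ _ Hf) (cts_ex_RInt _ _ _ Hf)).
  unfold plus in E2, E3; simpl in E2, E3; lra.
Qed.

Lemma L2ip_shift f g c :
  periodic1 f -> periodic1 g -> cts f -> cts g ->
  L2ip f (fun x => g (x - c)) = L2ip (fun x => f (x + c)) g.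
Proof.
  intros Hfp Hgp Hf Hg; unfold L2ip.
  rewrite <- (RInt_shift (fun x => f x * g (x - c)) c).
  - apply RInt_eq; intro x; replace (x + c - c) with x by ring; reflexivity.
  - intro x; rewrite Hfp; f_equal; rewrite <- (Hgp (x - c)); f_equal; ring.
  - cts_tac.
Qed.

(** * Linear elements and Simpson's rule *)

Lemma ispoly_1 p : ispoly 1 p -> forall x, p x = p 0 + (p 1 - p 0) * x.
Proof.
  intros [c Hc] x; rewrite !Hc; unfold poly_eval; simpl; ring.
Qed.

Lemma RInt_linear_mult a b c d :
  @eq R (RInt (fun s => (a + b * s) * (c + d * s)) 0 1) (a * c + (a * d + b * c) / 2 + b * d / 3).
Proof.
  apply (@is_RInt_unique R_CompleteNormedModule).
  set (F := fun s => a * c * s + (a * d + b * c) / 2 * s ^ 2 + b * d / 3 * s ^ 3).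
  replace (a * c + (a * d + b * c) / 2 + b * d / 3) with (F 1 - F 0) by (unfold F; field).
  apply (is_RInt_derive F).
  - intros x _; unfold F; auto_derive; [trivial | field].
  - intros x _; revert x; change (cts (fun s => (a + b * s) * (c + d * s))); cts_tac.
Qed.

(** The element mass matrix, with entries 1/3 on the diagonal and 1/6 off it. *)
Lemma L2ip_linear p g :
  ispoly 1 p -> ispoly 1 g ->
  L2ip p g = (2 * p 0 * g 0 + p 0 * g 1 + p 1 * g 0 + 2 * p 1 * g 1) / 6.
Proof.
  intros Hp Hg; rewrite (L2ip_ext p _ g _ (ispoly_1 p Hp) (ispoly_1 g Hg)).
  unfold L2ip; rewrite RInt_linear_mult; field.
Qed.

Lemma L2ip_Derive_linear p g :
  ispoly 1 p -> ispoly 1 g -> L2ip (Derive p) g = (p 1 - p 0) * (g 0 + g 1) / 2.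
Proof.
  intros Hp Hg.
  rewrite (L2ip_ext (Derive p) (fun s => (p 1 - p 0) + 0 * s)
             g (fun s => g 0 + (g 1 - g 0) * s)).
  - unfold L2ip; rewrite RInt_linear_mult; field.
  - intro x; rewrite (Derive_ext p (fun s => p 0 + (p 1 - p 0) * s)) by (apply ispoly_1, Hp).
    apply is_derive_unique; auto_derive; [trivial | ring].
  - apply ispoly_1, Hg.
Qed.

(* Discrete integration by parts: on a uniform mesh the central difference and the mass matrix
   commute. *)
Lemma linear_derivative_pairing n p w (P G : nat -> R -> R) :
  let N := INR (S n) in
  Vhk (S n) 1 p -> Vhk (S n) 1 w ->
  let phi := fun x => 2 / 3 * w x + 1 * (1 / 6 * w (x - / N) + 1 / 6 * w (x + / N)) in
  let psi := fun x => N / 2 * w (x - / N) + (- N / 2) * w (x + / N) in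
  Vhk (S n) 1 phi -> Vhk (S n) 1 psi ->
  (forall i, (i <= n)%nat ->
    ispoly 1 (P i) /\ forall s, 0 <= s <= 1 -> p ((INR i + s) / N) = P i s) ->
  (forall i, (i <= n)%nat ->
    ispoly 1 (G i) /\ forall s, 0 <= s <= 1 -> phi ((INR i + s) / N) = G i s) ->
  sum_f_R0 (fun i => L2ip (Derive (P i)) (G i)) n = L2ip p psi.
Proof.
  intros N Hp Hw phi psi Hphi Hpsi HP HG.
  assert (HN : 0 < N) by apply INR_S_pos.
  destruct (Vhk_cells _ _ _ Hpsi) as [Q HQ].
  rewrite (L2ip_cells p psi n) by (eapply Vhk_cts; eassumption); fold N in HQ |- *.
  (* On each cell the two sides differ exactly by an increment of [T], which is periodic in the
     node, so the increments sum to zero. *)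
  set (T := fun i => p (INR i / N) *
    (w (INR i / N - / N) + 2 * w (INR i / N) + w (INR i / N + / N)) / 4).
  assert (E : sum_f_R0 (fun i => L2ip (Derive (P i)) (G i)) n
    = sum_f_R0 (fun i => T (S i) - T i) n
      + sum_f_R0 (fun i => L2ip (fun s => p ((INR i + s) / N))
                                (fun s => psi ((INR i + s) / N))) n / N).
  { rewrite Rdiv_def, Rmult_comm, scal_sum, <- plus_sum; apply sum_eq; intros i Hi.
    destruct (HP i Hi) as [HPp HPe]; destruct (HG i Hi) as [HGp HGe].
    destruct (HQ i Hi) as [HQp HQe].
    rewrite (L2ip_ext_01 (fun s => p ((INR i + s) / N)) (P i) (fun s => psi ((INR i + s) / N)) (Q i))
      by (intros s Hs; (apply HPe || apply HQe); lra).
    rewrite L2ip_Derive_linear, L2ip_linear by assumption.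
    rewrite <- !HPe, <- !HGe, <- !HQe by lra.
    unfold T, phi, psi; rewrite S_INR, Rplus_0_r.
    replace ((INR i + 1) / N - / N) with (INR i / N) by (field; lra).
    replace ((INR i + 1) / N) with (INR i / N + / N) by (field; lra).
    field; lra. }
  rewrite E, sum_telescope.
  replace (T (S n) - T 0%nat) with 0; [ring|].
  destruct Hp as [[Hpp _] _]; destruct Hw as [[Hwp _] _].
  unfold T; fold N; replace (N / N) with (0 + 1) by (field; lra).
  replace (INR 0 / N) with 0 by (simpl; field; lra).
  replace (0 + 1 - / N) with (0 - / N + 1) by ring.
  replace (0 + 1 + / N) with (0 + / N + 1) by ring.
  rewrite Hpp, !Hwp; ring.
Qed.

(** Simpson's rule is exact on cubics: expanding [u] to order 4 and [u'] to order 3 about the left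
    end [x - h], all Taylor terms cancel and three remainders are left. *)
Lemma simpson_bound u M x h :
  (forall j y, (j < 5)%nat -> ex_derive (Derive_n u j) y) ->
  (forall y, Rabs (Derive_n u 5 y) <= M) -> 0 < h ->
  Rabs ((u (x + h) - u (x - h)) / (2 * h)
        - (Derive u (x - h) + 4 * Derive u x + Derive u (x + h)) / 6) <= 20 * h ^ 4 * M.
Proof.
  intros Hd HM Hh; set (y := x - h).
  assert (H5 := taylor_bound 4 u M y (2 * h) Hd HM ltac:(lra)).
  assert (Hd' : forall j z, (j < 4)%nat -> ex_derive (Derive_n (Derive u) j) z).
  { intros j z Hj; apply (ex_derive_ext (Derive_n u (S j))); [|apply Hd; lia].
    intro t; change (Derive u) with (Derive_n u 1).
    rewrite Derive_n_comp, Nat.add_1_r; reflexivity. }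
  assert (H4 := fun t => taylor_bound 3 (Derive u) M y t Hd' HM).
  assert (H41 := H4 h ltac:(lra)); assert (H42 := H4 (2 * h) ltac:(lra)).
  replace (y + 2 * h) with (x + h) in * by (unfold y; ring).
  replace (y + h) with x in * by (unfold y; ring).
  set (s5 := sum_f_R0 _ 4) in H5.
  set (s41 := sum_f_R0 _ 3) in H41.
  set (s42 := sum_f_R0 _ 3) in H42.
  assert (E : (u (x + h) - u y) / (2 * h) - (Derive u y + 4 * Derive u x + Derive u (x + h)) / 6
    = / (2 * h) * (u (x + h) - s5) - 2 / 3 * (Derive u x - s41) - 1 / 6 * (Derive u (x + h) - s42)).
  { unfold s5, s41, s42; simpl; change (fun x0 => u x0) with u; field; lra. }
  rewrite E.
  assert (H5' : Rabs (/ (2 * h) * (u (x + h) - s5)) <= 16 * (h ^ 4 * M)).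
  { rewrite Rabs_mult, Rabs_pos_eq by (left; apply Rinv_0_lt_compat; lra).
    apply (Rmult_le_reg_l (2 * h)); [lra|].
    rewrite <- Rmult_assoc, Rinv_r, Rmult_1_l by lra.
    eapply Rle_trans; [exact H5|]; right; ring. }
  replace ((2 * h) ^ 4 * M) with (16 * (h ^ 4 * M)) in H42 by ring.
  rewrite Rmult_assoc.
  (* The remainders contribute 16, 2/3 and 16/6 times [h ^ 4 * M], together less than 20. *)
  apply Rabs_le_between in H5', H41, H42; apply Rabs_le_between; lra.
Qed.

(* With [w+], [w-] the translates of [w] by one mesh size, testing the projection against
   [(w- + 4 w + w+) / 6] moves [Pu] onto [(w- - w+) / (2 h)], where it may be replaced by [u];
   translating back leaves the error of Simpson's rule for [u'] on [[x - h, x + h]], tested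
   against [w]. *)
Lemma estimate_linear u n M Pu w :
  Cpm 5 u -> (forall x, Rabs (Derive_n u 5 x) <= M) ->
  is_L2proj (S n) 1 u Pu -> is_L2proj (S n) 1 (dx_diff Pu u) w ->
  L2norm w <= 60 * (/ INR (S n)) ^ 4 * M.
Proof.
  intros Hu HM [HPu HPo] [Hw Hwo].
  assert (HM0 : 0 <= M) by (eapply Rle_trans; [apply Rabs_pos | apply (HM 0)]).
  assert (HN := INR_S_pos n).
  assert (Hwm := Vhk_shift_neg _ _ _ Hw); assert (Hwp := Vhk_shift _ _ _ Hw).
  set (N := INR (S n)) in *.
  set (phi := fun x => 2 / 3 * w x + 1 * (1 / 6 * w (x - / N) + 1 / 6 * w (x + / N))).
  set (psi := fun x => N / 2 * w (x - / N) + (- N / 2) * w (x + / N)).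
  assert (Hphi : Vhk (S n) 1 phi) by (apply Vhk_lin; [exact Hw | apply Vhk_lin; assumption]).
  assert (Hpsi : Vhk (S n) 1 psi) by (apply Vhk_lin; assumption).
  destruct (Vhk_cells _ _ _ HPu) as [P HP]; destruct (Vhk_cells _ _ _ Hphi) as [G HG].
  assert (Hu1 := Cpm_is_C1 _ _ Hu).
  assert (Hu1' := Hu1); destruct Hu1' as [Hud Hduc].
  destruct Hu as ([Hup Huc] & Hd & Hc); change (cts u) in Huc.
  assert (Hdup : periodic1 (Derive u)) by (destruct (Hc 1%nat) as [H _]; [lia | exact H]).
  assert (HPc := Vhk_cts _ _ _ HPu); assert (Hwc := Vhk_cts _ _ _ Hw).
  assert (Hphic := Vhk_cts _ _ _ Hphi); assert (Hpsic := Vhk_cts _ _ _ Hpsi).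
  assert (Hwper : periodic1 w) by (destruct Hw as [[H _] _]; exact H).
  assert (Hpair := linear_derivative_pairing n Pu w P G HPu Hw Hphi Hpsi HP HG).
  fold N psi in Hpair.
  assert (E1 : L2ip w phi = L2ip Pu psi - L2ip (Derive u) phi).
  { assert (E := is_RInt_dx_diff n 1 Pu u phi P G Hu1 HP HG); fold N in E.
    rewrite (L2proj_dx_diff (S n) 1 (dx_diff Pu u) w phi (conj Hw Hwo) Hphi)
      by (eexists; exact E).
    rewrite <- Hpair, (L2ip_cells (Derive u) phi n) by assumption; fold N.
    refine (@eq_trans R _ _ _ (@is_RInt_unique R_CompleteNormedModule _ _ _ _ E) _).
    match goal with |- ?a / N = ?b - ?c / N =>
      cut (a = N * b - c); [intro E'; rewrite E'; field; lra|] end.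
    rewrite scal_sum, <- minus_sum; apply sum_eq; intros i Hi.
    destruct (HP i Hi) as [HPp _]; destruct (HG i Hi) as [HGp HGe].
    rewrite (L2ip_ext_01 (fun s => Derive u ((INR i + s) / N)) (fun s => Derive u ((INR i + s) / N))
               (fun s => phi ((INR i + s) / N)) (G i)) by (intros; try apply HGe; lra).
    rewrite (L2ip_ext _ (fun s => N * Derive (P i) s + (-1) * Derive u ((INR i + s) / N)) (G i) (G i))
      by (intro; ring).
    assert (HdP := ispoly_cts _ _ (ispoly_Derive _ _ HPp)).
    assert (HGc := ispoly_cts _ _ HGp).
    rewrite L2ip_lin_l by cts_tac; ring. }
  assert (E2 : L2ip Pu psi = L2ip u psi).
  { assert (E := HPo _ Hpsi).
    rewrite (L2ip_ext _ (fun x => 1 * u x + (-1) * Pu x) psi psi) in E by (intro; ring).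
    rewrite L2ip_lin_l in E by assumption; lra. }
  (* Both translates are written as subtractions so that [L2ip_shift] applies to each. *)
  set (wm := fun x => w (x - / N)); set (wp := fun x => w (x - (- / N))).
  assert (Hwmc : cts wm) by (unfold wm; cts_tac).
  assert (Hwpc : cts wp) by (unfold wp; cts_tac).
  assert (Ephi : forall x, phi x = 2 / 3 * w x + 1 * (1 / 6 * wm x + 1 / 6 * wp x)).
  { intro x; unfold phi, wm, wp; replace (x - - / N) with (x + / N) by ring; reflexivity. }
  assert (Epsi : forall x, psi x = N / 2 * wm x + (- N / 2) * wp x).
  { intro x; unfold psi, wm, wp; replace (x - - / N) with (x + / N) by ring; reflexivity. }
  set (S := fun x => (u (x + / N) - u (x - / N)) / (2 * / N)
    - (Derive u (x - / N) + 4 * Derive u x + Derive u (x + / N)) / 6).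
  assert (HSc : cts S) by (unfold S; cts_tac).
  assert (Hum : cts (fun x => u (x + - / N))) by cts_tac.
  assert (Hupl : cts (fun x => u (x + / N))) by cts_tac.
  assert (Hdum : cts (fun x => Derive u (x + - / N))) by cts_tac.
  assert (Hdupl : cts (fun x => Derive u (x + / N))) by cts_tac.
  assert (E3 : L2ip w phi = L2ip S w).
  { rewrite E1, E2.
    rewrite (L2ip_ext u u psi _ (fun x => eq_refl) Epsi).
    rewrite (L2ip_ext (Derive u) (Derive u) phi _ (fun x => eq_refl) Ephi).
    rewrite !L2ip_lin_r by cts_tac.
    unfold wm, wp; rewrite !L2ip_shift by assumption.
    rewrite (L2ip_ext S (fun x => N / 2 * u (x + / N) + 1 * ((- N / 2) * u (x + - / N)
        + 1 * ((- 1 / 6) * Derive u (x + - / N)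
        + 1 * ((- 2 / 3) * Derive u x + (- 1 / 6) * Derive u (x + / N))))) w w); cycle 1.
    - intro x; unfold S, Rminus; field; lra.
    - reflexivity.
    - rewrite !L2ip_lin_l by cts_tac; field. }
  assert (Hself : forall c, L2ip (fun x => w (x - c)) (fun x => w (x - c)) = L2ip w w).
  { intro c; rewrite L2ip_shift; [|intro x; rewrite <- (Hwper (x - c)); f_equal; ring
      | exact Hwper | cts_tac | exact Hwc].
    apply L2ip_ext; intro x; f_equal; ring. }
  (* Translates have the same norm, so each pairing of [w] with one is at least [- L2ip w w], and
     [2/3 - 1/6 - 1/6 = 1/3]. *)
  assert (Hcoer : L2ip w w / 3 <= L2ip w phi).
  { rewrite (L2ip_ext w w phi _ (fun x => eq_refl) Ephi), !L2ip_lin_r by cts_tac.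
    assert (Hm := L2ip_ge_0 (fun x => 1 * w x + 1 * wm x) ltac:(cts_tac)).
    assert (Hp := L2ip_ge_0 (fun x => 1 * w x + 1 * wp x) ltac:(cts_tac)).
    rewrite L2ip_sq_lin in Hm, Hp by assumption.
    unfold wm at 2 3 in Hm; unfold wp at 2 3 in Hp; rewrite Hself in Hm, Hp; lra. }
  (* The weight 3 leaves [L2ip w w / 6] to absorb into the third, so [L2ip w w <= 9 * L2ip S S], and
     the final constant is [3 * 20 = 60]. *)
  assert (Hy := L2ip_young S w 3 HSc Hwc ltac:(lra)).
  assert (HiN : 0 < / N) by (apply Rinv_0_lt_compat, HN).
  assert (Hb : 0 <= 20 * (/ N) ^ 4 * M).
  { apply Rmult_le_pos; [apply Rmult_le_pos; [lra | apply pow_le; lra] | exact HM0]. }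
  assert (HS := L2ip_sq_le S _ HSc Hb (fun x _ => simpson_bound u M x (/ N) Hd HM HiN)).
  apply L2norm_le; [lra|].
  replace ((60 * (/ N) ^ 4 * M) ^ 2) with (9 * (20 * (/ N) ^ 4 * M) ^ 2) by ring.
  lra.
Qed.

Theorem theorem2p8 :
  (* (i) k = 2 kappa + 1 *)
  (forall kappa : nat,
     let k := (2 * kappa + 1)%nat in
     exists C : R, 0 < C /\
       forall (u : R -> R), Cpm (k + 2) u ->
       forall (N : nat), (1 <= N)%nat ->
       forall (M : R), (forall x, Rabs (Derive_n u (k + 2) x) <= M) ->
       forall (Pu w : R -> R),
         is_L2proj N k u Pu ->
         is_L2proj N k (dx_diff Pu u) w ->
         L2norm w <= C * (1 / INR N) ^ (k + 1) * M)
  /\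
  (* (ii) k = 1 *)
  (exists C : R, 0 < C /\
     forall (u : R -> R), Cpm 5 u ->
     forall (N : nat), (1 <= N)%nat ->
     forall (M : R), (forall x, Rabs (Derive_n u 5 x) <= M) ->
     forall (Pu w : R -> R),
       is_L2proj N 1 u Pu ->
       is_L2proj N 1 (dx_diff Pu u) w ->
       L2norm w <= C * (1 / INR N) ^ 4 * M).
Proof.
  split.
  - intros kappa k.
    destruct (estimate_odd k) as (C & HC & H);
      [unfold k; lia | exists (kappa + 1)%nat; unfold k; lia |].
    replace (k + 2)%nat with (S (S k)) by lia; replace (k + 1)%nat with (S k) by lia.
    exists C; split; [exact HC|].
    intros u Hu [|n] HN M HM Pu w HPu Hw; [lia|].
    unfold Rdiv; rewrite Rmult_1_l; exact (H u Hu n M HM Pu w HPu Hw).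
  - exists 60; split; [lra|].
    intros u Hu [|n] HN M HM Pu w HPu Hw; [lia|].
    unfold Rdiv; rewrite Rmult_1_l; exact (estimate_linear u n M Pu w Hu HM HPu Hw).
Qed.
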